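(* The problem \texttt{IStoIC-MC} can be solved in time $O(n^4)$, where $n$ is the number of agents of the input marriage instance. That is, there is an algorithm which, given a marriage instance $T$ with $n$ agents and a stable table $T^0\subseteq T$, outputs in time $O(n^4)$ a subtable $T'\subseteq T$ such that $\mathcal{S}(T')$ is an internal closure of $\mathcal{S}(T^0)$.
   Context: A roommate instance $T$ consists of a finite set $A$ of agents; each agent $z$ has a set $A(z)\subseteq A\setminus\{z\}$ of acceptable agents, strictly ordered by $>_z$, and acceptability is symmetric ($w\in A(z)$ iff $z\in A(w)$). A pair $zw$ with $w\in A(z)$ is an edge of $T$. A marriage instance is a roommate instance whose agent set is partitioned into $X$ and $Y$ such that every edge joins an agent of $X$ and an agent of $Y$. A matching is a set of pairwise disjoint edges; $M(z)$ is the partner of $z$ in $M$ (or $\emptyset$ if unmatched), and every acceptable agent is strictly preferred to $\emptyset$. An edge $ab$ blocks $M$ if $b>_a M(a)$ and $a>_b M(b)$; $M$ is stable if no edge blocks it; a matching $M'$ blocks $M$ if some edge of $M'$ blocks $M$. $\mathcal{M}(T)$ and $\mathcal{S}(T)$ denote the sets of matchings and stable matchings of $T$. A subtable $T'\subseteq T$ is a subset of the edges of $T$ with each agent's preference order being the restriction of its order in $T$. $T'$ is a stable table if every edge of $T'$ belongs to some stable matching of $T'$. A set of matchings is internally stable if no two of its members block each other; it is internally closed if it is internally stable and inclusionwise maximal with this property among subsets of $\mathcal{M}(T)$. An internal closure of an internally stable set $\mathcal{M}'$ is an internally closed set containing $\mathcal{M}'$. *)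

(* Defs.v *)
From mathcomp Require Import all_boot.

Set Implicit Arguments.
Unset Strict Implicit.
Unset Printing Implicit Defensive.

(* [pref T z] lists A(z) from the most to the least preferred agent, so that
   [w >_z w'] iff [w] occurs before [w'].  Subtables are represented by the same
   type, on the same agents. *)
Record instance (A : finType) := Instance {
  pref : A -> seq A;
  pref_uniq : forall z, uniq (pref z);
  pref_irr : forall z, z \notin pref z;
  pref_sym : forall z w, (w \in pref z) = (z \in pref w)
}.

Section Matchings.
Variable A : finType.
Implicit Types (T : instance A) (M : {set {set A}}) (F : {set {set {set A}}}).

Definition edges T : {set {set A}} :=
  [set e | [exists z, exists w, (w \in pref T z) && (e == [set z; w])]].

(* The two sides of the partition are [X] and its complement. *)
Definition marriage T (X : {set A}) : bool :=
  [forall z, forall w, (w \in pref T z) ==> ((z \in X) != (w \in X))].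

Definition is_matching T M : bool := (M \subset edges T) && trivIset M.

Definition partner M (z : A) : option A :=
  [pick w | (w != z) && ([set z; w] \in M)].

(* [b >_a o], where [None] stands for being unmatched. *)
Definition prefers T (a b : A) (o : option A) : bool :=
  (b \in pref T a) &&
  (if o is Some c then index b (pref T a) < index c (pref T a) else true).

Definition edge_blocks T (a b : A) M : bool :=
  [&& b \in pref T a, prefers T a b (partner M a) & prefers T b a (partner M b)].

Definition is_stable T M : bool :=
  is_matching T M && [forall a, forall b, ~~ edge_blocks T a b M].

Definition matching_blocks T M' M : bool :=
  [exists a, exists b, ([set a; b] \in M') && edge_blocks T a b M].

Definition matchings T : {set {set {set A}}} := [set M | is_matching T M].
Definition stable_matchings T : {set {set {set A}}} := [set M | is_stable T M].

Definition subtable T' T : bool :=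
  (edges T' \subset edges T) &&
  [forall z, pref T' z == [seq w <- pref T z | w \in pref T' z]].

Definition stable_table T : bool :=
  [forall e in edges T, exists M in stable_matchings T, e \in M].

Definition internally_stable T F : bool :=
  (F \subset matchings T) &&
  [forall M in F, forall M' in F, ~~ matching_blocks T M' M].

Definition internally_closed T F : bool := maxset (internally_stable T) F.

Definition internal_closure T F' F : bool :=
  internally_closed T F && (F' \subset F).

End Matchings.

(* Structured programs over registers and finitely many arrays (array names are
   literals of the program), all cells holding machine words.  A word is a
   natural number below [W]; arithmetic wraps around, except that subtraction is
   truncated at 0.  Comparisons return 0 or 1. *)
Inductive binop := Add | Sub | Mul | Ltn | Eqn.

Inductive expr :=
| Cst of nat
| Reg of nat
| Get of nat & expr
| Bin of binop & expr & expr.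

Inductive cmd :=
| Skip
| SetReg of nat & expr
| Put of nat & expr & expr
| Seq of cmd & cmd
| If of expr & cmd & cmd
| While of expr & cmd.

Record state := State { reg : nat -> nat; arr : nat -> nat -> nat }.

Definition update (T : Type) (f : nat -> T) (x : nat) (v : T) : nat -> T :=
  fun y => if y == x then v else f y.

Definition set_reg (s : state) (x v : nat) : state :=
  State (update (reg s) x v) (arr s).

Definition set_arr (s : state) (a i v : nat) : state :=
  State (reg s) (update (arr s) a (update (arr s a) i v)).

Definition binop_val (o : binop) (x y : nat) : nat :=
  match o with
  | Add => x + y
  | Sub => x - y
  | Mul => x * y
  | Ltn => x < y
  | Eqn => x == y
  end.

Fixpoint eval (W : nat) (s : state) (e : expr) : nat :=
  match e with
  | Cst k => k %% W
  | Reg x => reg s x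
  | Get a e1 => arr s a (eval W s e1)
  | Bin o e1 e2 => binop_val o (eval W s e1) (eval W s e2) %% W
  end.

Fixpoint expr_cost (e : expr) : nat :=
  match e with
  | Cst _ | Reg _ => 1
  | Get _ e1 => (expr_cost e1).+1
  | Bin _ e1 e2 => (expr_cost e1 + expr_cost e2).+1
  end.

(* [exec W p s t s']: with words below [W], the program [p] started in [s] halts
   in [s'] after exactly [t] time units. *)
Inductive exec (W : nat) : cmd -> state -> nat -> state -> Prop :=
| ExecSkip s : exec W Skip s 1 s
| ExecSetReg s x e :
    exec W (SetReg x e) s (expr_cost e).+1 (set_reg s x (eval W s e))
| ExecPut s a i e :
    exec W (Put a i e) s (expr_cost i + expr_cost e).+1
      (set_arr s a (eval W s i) (eval W s e))
| ExecSeq s1 s2 s3 t1 t2 p q :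
    exec W p s1 t1 s2 -> exec W q s2 t2 s3 ->
    exec W (Seq p q) s1 (t1 + t2).+1 s3
| ExecIfTrue s s' t e p q :
    eval W s e != 0 -> exec W p s t s' ->
    exec W (If e p q) s (expr_cost e + t).+1 s'
| ExecIfFalse s s' t e p q :
    eval W s e = 0 -> exec W q s t s' ->
    exec W (If e p q) s (expr_cost e + t).+1 s'
| ExecWhileTrue s1 s2 s3 t1 t2 e p :
    eval W s1 e != 0 -> exec W p s1 t1 s2 -> exec W (While e p) s2 t2 s3 ->
    exec W (While e p) s1 (expr_cost e + t1 + t2).+1 s3
| ExecWhileFalse s e p :
    eval W s e = 0 -> exec W (While e p) s (expr_cost e).+1 s.

Section Encoding.
Variable n : nat.
Implicit Types T : instance 'I_n.

Definition side_array (X : {set 'I_n}) (i : nat) : nat :=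
  if insub i is Some z then z \in X else false.

Definition length_array T (i : nat) : nat :=
  if insub i is Some z then size (pref T z) else 0.

(* Row-major: cell [z * n + j] holds the [j]-th agent of [z]'s list, and the
   cells past the end of that list hold 0. *)
Definition pref_array T (i : nat) : nat :=
  if insub (i %/ n) is Some z then nth 0 (map val (pref T z)) (i %% n) else 0.

Definition input_state T (X : {set 'I_n}) (T0 : instance 'I_n) : state :=
  State
    (fun x => if x == 0 then n else 0)
    (fun a => match a with
              | 0 => side_array X
              | 1 => length_array T
              | 2 => pref_array T
              | 3 => length_array T0
              | 4 => pref_array T0
              | _ => fun _ => 0
              end).

(* Array 5 holds the lengths and array 6 the rows of the output table. *)
Definition output_is (s : state) (T' : instance 'I_n) : Prop :=
  forall z : 'I_n,
    map val (pref T' z) = mkseq (fun j => arr s 6 (z * n + j)) (arr s 5 z).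

End Encoding.

(* Main.v *)
Require Import Defs.
From mathcomp Require Import all_boot perm zify.

Set Implicit Arguments.
Unset Strict Implicit.
Unset Printing Implicit Defensive.

(** A set [F] of matchings of the form [S(T')], with [T'] a stable table, can be
    enlarged by a matching [m] iff [m] and all members of [F] are stable in
    [T' + m].  Stable matchings have opposite interests on the two sides of an
    edge, so an edge [xy] of [m] outside [T'] is of one of three kinds.
    - [x] prefers [y] to its best partner in [T'].  Then the join of [m] with the
      [X]-optimal matching [N0] is a trade in which every [x] weakly improves and
      every [y] weakly loses; running top trading cycles from [N0] once adds a
      matching after which no such trade is left, because a remaining profitable
      arc always points to an agent that left in an earlier round.
    - The same with the two sides exchanged.
    - [y] lies strictly between two [T']-neighbours of [x], and vice versa.  In a
      stable table the rotations are the cycles of an explicit successor map on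
      edges, and [xy] is compatible with [F] iff the edges from [x] to its next
      better and from [y] to its next worse neighbour lie on one rotation; then [xy] alone can be added, since
      closing up part of the rotation with [xy] gives a stable matching.
    Compatibility with [F] only gets harder when [F] grows, so one pass over the
    [n^2] edges of the third kind, walking each time along a rotation of length at
    most [n] with linear-time steps, suffices. *)

(** * Stable matchings as involutions *)

(** No phase has to be repeated because each leaves a certificate that later enlargements cannot
    spoil. For a trading phase it is [acyclic_over], a condition on one matching and the preferences
    of [T] that mentions no table: while that matching stays stable, no stable matching of any
    larger table improves on it for that side. For a rejected middle edge it is the failure of
    [consistent], a condition on all stable matchings of the table, hence harder to meet when there
    are more of them. An agent improving beyond its optimal partner takes somebody else's partner,
    whose owner must be compensated in turn. Such edges enter as a whole matching, which is why the
    outer two kinds need trading cycles. The two matchings so obtained then provide, for every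
    remaining middle edge, stable partners of [y] on both sides of [x], which is what the rotation
    test starts from. *)

Section Rank.
Variables (A : finType) (T : instance A).

(* An agent is never on its own list, so [rk a a] is the length of the list and
   ranks as worse than every acceptable agent. *)
Definition rk (a b : A) : nat := index b (pref T a).

Lemma rk_max a b : rk a b <= rk a a.
Proof. by rewrite /rk (memNindex (pref_irr T a)) index_size. Qed.

Lemma rk_self a b : (rk a b < rk a a) = (b \in pref T a).
Proof. by rewrite /rk (memNindex (pref_irr T a)) index_mem. Qed.

Lemma rk_ltW a b c : rk a b < rk a c -> b \in pref T a.
Proof. by move=> h; rewrite -rk_self (leq_trans h) ?rk_max. Qed.

Lemma rk_inj a b c : b \in pref T a -> rk a b = rk a c -> b = c.
Proof.
move=> hb e; have hc : c \in pref T a by rewrite -index_mem -/(rk a c) -e /rk index_mem.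
by rewrite -(nth_index b hb) -(nth_index b hc) -/(rk a b) -/(rk a c) e.
Qed.

Lemma rk_lt_le a b c : b \in pref T a -> b <> c -> rk a b <= rk a c -> rk a b < rk a c.
Proof.
move=> hb hbc; rewrite leq_eqVlt => /orP[/eqP e|//].
by case: hbc; apply: rk_inj e.
Qed.

Lemma pref_neq a b : b \in pref T a -> b <> a.
Proof. by move=> h e; move: (pref_irr T a); rewrite -{1}e h. Qed.

Implicit Types (E : rel A) (m N : {ffun A -> A}).

(* A matching is an involution whose fixed points are the unmatched agents, and a
   subtable of [T] is an adjacency relation [E]. *)
Definition St E m : bool :=
  [&& [forall z, m (m z) == z], [forall z, (m z != z) ==> E z (m z)] &
      [forall a, forall b, E a b ==>
         ~~ ((rk a b < rk a (m a)) && (rk b a < rk b (m b)))]].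

Lemma StP E m :
  reflect [/\ involutive m, forall z, m z <> z -> E z (m z) &
    forall a b, E a b -> rk a b < rk a (m a) -> rk b a < rk b (m b) -> False]
    (St E m).
Proof.
apply: (iffP and3P) => -[h1 h2 h3]; split.
- by move=> z; apply/eqP/(forallP h1).
- by move=> z /eqP hz; apply: (implyP (forallP h2 z)).
- move=> a b hab h h'; move: (implyP (forallP (forallP h3 a) b) hab).
  by rewrite h h'.
- by apply/forallP => z; rewrite h1.
- by apply/forallP => z; apply/implyP => /eqP; apply: h2.
- apply/forallP => a; apply/forallP => b; apply/implyP => hab.
  by apply/negP => /andP[]; apply: h3 hab.
Qed.

Definition subT E := forall a b, E a b -> b \in pref T a.

Lemma St_invol E m : St E m -> involutive m. Proof. by case/StP. Qed.
Lemma St_edge E m z : St E m -> m z <> z -> E z (m z).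
Proof. by case/StP => _ h _; apply: h. Qed.
Lemma St_nb E m a b : St E m -> E a b ->
  rk a b < rk a (m a) -> rk b a < rk b (m b) -> False.
Proof. by case/StP => _ _; apply. Qed.

Lemma lt_matched m z w : rk z (m z) < rk z w -> m z <> z.
Proof. by move=> h e; move: h; rewrite e ltnNge rk_max. Qed.

(** Otherwise [z] and [m1 z] would block [m2]; a tie is excluded, since it would make them partners
    in [m2] as well. *)
Lemma St_opp1 E m1 m2 z : subT E -> St E m1 -> St E m2 ->
  rk z (m1 z) < rk z (m2 z) -> rk (m1 z) (m2 (m1 z)) < rk (m1 z) z.
Proof.
move=> sE s1 s2 h; have hE := St_edge s1 (lt_matched h).
rewrite ltnNge; apply/negP => h'.
have hz : z \in pref T (m1 z) by rewrite -pref_sym; apply: sE.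
apply: (St_nb s2 hE h); apply: rk_lt_le h' => // e.
have e2 : m2 z = m1 z by rewrite {1}e (St_invol s2).
by move: h; rewrite e2 ltnn.
Qed.

(* The agents preferring [m1] and those preferring [m2] are exchanged injectively
   by [m1] and by [m2], hence bijectively. *)
Lemma St_opp2 E m1 m2 z : subT E -> St E m1 -> St E m2 ->
  rk z (m1 z) < rk z (m2 z) -> rk (m2 z) z < rk (m2 z) (m1 (m2 z)).
Proof.
move=> sE s1 s2 h.
pose P := [set z | rk z (m1 z) < rk z (m2 z)].
pose Q := [set z | rk z (m2 z) < rk z (m1 z)].
have i1 : injective m1 := can_inj (St_invol s1).
have i2 : injective m2 := can_inj (St_invol s2).
have PQ : m1 @: P \subset Q.
  apply/subsetP => _ /imsetP[w hw ->]; rewrite !inE in hw *.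
  by rewrite (St_invol s1); apply: (St_opp1 sE s1 s2).
have QP : m2 @: Q \subset P.
  apply/subsetP => _ /imsetP[w hw ->]; rewrite !inE in hw *.
  by rewrite (St_invol s2); apply: (St_opp1 sE s2 s1).
have cP : #|P| <= #|Q| by rewrite -(card_imset _ i1) subset_leq_card.
have : m2 @: Q == P by rewrite eqEcard QP card_imset.
move/eqP => e; have : z \in m2 @: Q by rewrite e inE.
by case/imsetP => w; rewrite inE => hw ->; rewrite (St_invol s2).
Qed.

Lemma St_oppE E m1 m2 z : subT E -> St E m1 -> St E m2 ->
  (rk z (m1 z) < rk z (m2 z)) = (rk (m1 z) (m2 (m1 z)) < rk (m1 z) z).
Proof.
move=> sE s1 s2; apply/idP/idP; first exact: (St_opp1 sE s1 s2).
move=> h; have := @St_opp2 E m2 m1 (m1 z) sE s2 s1.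
by rewrite (St_invol s1); apply.
Qed.

Record good E : Prop := Good {
  good_sym : symmetric E;
  good_sub : subT E;
  good_st : forall a b, E a b -> exists2 m, St E m & m a = b;
  good_ne : exists m, St E m }.

(** Some stable matching contains [x y]; comparing [m] with it turns the opposite interests of two
    stable matchings into a statement about one matching and one edge. *)
Lemma edge_opp E m x y : good E -> St E m -> E x y ->
  (rk x (m x) < rk x y) = (rk y x < rk y (m y)).
Proof.
move=> gE sm hxy; have sE := good_sub gE.
have [m' sm' e] := good_st gE hxy.
apply/idP/idP => h.
  by have := @St_opp2 E m m' x sE sm sm'; rewrite e; apply.
have ey : m' y = x by rewrite -e (St_invol sm').
by have := @St_opp1 E m' m y sE sm' sm; rewrite ey; apply.
Qed.

(** The rural hospitals phenomenon. Were [x] alone in [m], a stable matching through [x y] would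
    suit it strictly better, and [St_opp2], applied with [x] as its own partner, would produce a
    rank above the maximal one. *)
Lemma edge_matched E m x y : good E -> St E m -> E x y -> m x <> x.
Proof.
move=> gE sm hxy e; have sE := good_sub gE.
have [m' sm' e'] := good_st gE hxy.
have h : rk x (m' x) < rk x (m x).
  by rewrite e e' rk_self; apply: sE.
by have := St_opp2 sE sm' sm h; rewrite e ltnNge rk_max.
Qed.

Lemma edge_partner E m x y : good E -> St E m -> E x y -> E x (m x).
Proof. by move=> gE sm hxy; apply: St_edge => //; apply: edge_matched hxy. Qed.

(* Returns [a] itself when no agent on its list satisfies [c]. *)
Definition sel (a : A) (c : pred A) : A := head a (filter c (pref T a)).

(** The default [a] has maximal rank, so with [d = a] minimality already says that nothing satisfies
    [c]. Success and failure of a linear search thus share one specification. *)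
Lemma sel_uniq a (c : pred A) d : (forall w, c w -> w \in pref T a) ->
  (d = a \/ c d) -> (forall w, c w -> rk a d <= rk a w) -> sel a c = d.
Proof.
move=> hc hd hmin; rewrite /sel.
case: hd => [ed|cd].
  have -> : filter c (pref T a) = [::]; last by [].
  apply/eqP; rewrite -[_ == _]negbK -has_filter; apply/hasPn => w hw.
  apply/negP => /hmin; rewrite ed leqNgt rk_self; by rewrite hw.
have hda := hc _ cd.
move: hmin (pref_uniq T a) hda; rewrite /rk.
elim: (pref T a) => //= b l IH hmin /andP[hb ul]; rewrite inE.
case cb : (c b) => /=.
  by have := hmin _ cb; rewrite eqxx; case: eqP => [->|].
case/orP => [/eqP e|hdl]; first by rewrite -e cd in cb.
apply: IH => // w cw; have := hmin _ cw.
have -> : (b == d) = false by apply/eqP => e; rewrite e cd in cb.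
by have -> : (b == w) = false by apply/eqP => e; rewrite e cw in cb.
Qed.

Lemma sel_default a (c : pred A) : (forall w, ~~ c w) -> sel a c = a.
Proof.
move=> hc; apply: sel_uniq; first by move=> w; rewrite (negbTE (hc w)).
  by left.
by move=> w; rewrite (negbTE (hc w)).
Qed.

Lemma selP a (c : pred A) w : (forall w, c w -> w \in pref T a) -> c w ->
  [/\ c (sel a c), sel a c <> a & forall u, c u -> rk a (sel a c) <= rk a u].
Proof.
move=> hc cw.
have [d cd hd] := arg_minnP (rk a) cw.
have -> : sel a c = d by apply: sel_uniq => //; right.
by split => //; apply/pref_neq/hc.
Qed.

Lemma sel_spec a (c : pred A) : sel a c <> a -> c (sel a c).
Proof.
rewrite /sel; case e : (filter _ _) => [//|b l] _ /=.
have : b \in filter c (pref T a) by rewrite e mem_head.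
by rewrite mem_filter => /andP[].
Qed.

(** [b] need not be a neighbour of [a] in [E]: the middle test asks for the neighbour that follows
    the place of an absent edge. *)
Definition nx E (a b : A) : A := sel a (fun w => E a w && (rk a b < rk a w)).

Lemma nx_neq E a b w : subT E -> E a w -> rk a b < rk a w -> nx E a b <> a.
Proof.
move=> sE h1 h2; rewrite /nx.
by case: (@selP a (fun w => E a w && (rk a b < rk a w)) w); rewrite ?h1 // => u /andP[/sE].
Qed.

Lemma nxP E a b : subT E -> nx E a b <> a ->
  [/\ E a (nx E a b), rk a b < rk a (nx E a b) &
      forall u, E a u -> rk a b < rk a u -> rk a (nx E a b) <= rk a u].
Proof.
move=> sE h; have /andP[h1 h2] := sel_spec h; split=> // u h3 h4.
have [||_ _ hmin] := @selP a (fun w => E a w && (rk a b < rk a w)) u.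
- by move=> w /andP[/sE].
- by rewrite h3.
by apply: hmin; rewrite h3.
Qed.

End Rank.

(** * The lattice structure in the bipartite case *)

Section Bipartite.
Variables (A : finType) (T : instance A) (X : {set A}).
Hypothesis mT : marriage T X.
Implicit Types (E : rel A) (m N : {ffun A -> A}).
Local Notation rk := (rk T).
Local Notation St := (St T).
Local Notation good := (good T).
Local Notation subT := (subT T).
Local Notation nx := (nx T).

Lemma side_pref z w : w \in pref T z -> (w \in X) = ~~ (z \in X).
Proof.
move=> h; move: (implyP (forallP (forallP mT z) w) h).
by case: (z \in X); case: (w \in X).
Qed.

Lemma marriageC : marriage T (~: X).
Proof.
apply/forallP => z; apply/forallP => w; apply/implyP => h.
by rewrite !inE (side_pref h); case: (z \in X).
Qed.

Lemma St_side E m z : subT E -> St E m -> m z <> z -> (m z \in X) = ~~ (z \in X).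
Proof. by move=> sE sm h; apply/side_pref/sE/(St_edge sm h). Qed.

(** The lattice meet in the order of the interests of [X]; the Boolean equality exchanges better and
    worse outside [X]. *)
Definition meet m1 m2 : {ffun A -> A} :=
  [ffun z => if (z \in X) == (rk z (m1 z) < rk z (m2 z)) then m2 z else m1 z].

Lemma meetX m1 m2 z : z \in X -> rk z (meet m1 m2 z) = maxn (rk z (m1 z)) (rk z (m2 z)).
Proof. by move=> hz; rewrite ffunE hz /maxn; case: ltnP. Qed.

Lemma meetY m1 m2 z : z \notin X -> rk z (meet m1 m2 z) = minn (rk z (m1 z)) (rk z (m2 z)).
Proof. by move=> hz; rewrite ffunE (negbTE hz) /minn; case: ltnP. Qed.

Lemma meet_or m1 m2 z : meet m1 m2 z = m1 z \/ meet m1 m2 z = m2 z.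
Proof. by rewrite ffunE; case: ifP => _; [right|left]. Qed.

(** An agent outside [X] that would improve on the meet would improve on both matchings, while its
    counterpart in [X] holds its partner from one of them; the edge would block that one. Opposite
    interests make the two definitions of the meet match up. *)
Lemma meet_St E m1 m2 : subT E -> St E m1 -> St E m2 -> St E (meet m1 m2).
Proof.
move=> sE s1 s2.
have i1 := St_invol s1; have i2 := St_invol s2.
(* Equal ranks identify partners only among acceptable agents, hence the separate case of an
   unmatched [z]. *)
have dich z : rk z (m2 z) <= rk z (m1 z) -> m2 z = z \/ m1 z = m2 z \/ rk z (m2 z) < rk z (m1 z).
  move=> h; case: (eqVneq (m2 z) z) => [|/eqP n2]; first by left.
  right; case: (eqVneq (m1 z) (m2 z)) => [|/eqP n12]; first by left.
  by right; apply: rk_lt_le h; [apply/sE/(St_edge s2)|apply/nesym].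
apply/StP; split.
- move=> z; rewrite [meet m1 m2 z]ffunE.
  case hz : (z \in X); case: (ltnP (rk z (m1 z)) (rk z (m2 z))) => h /=.
  + have h2 := St_opp2 sE s1 s2 h.
    have hw : m2 z <> z by move=> e; move: h2; rewrite e ltnNge rk_max.
    by rewrite ffunE (St_side sE s2 hw) hz i2 ltnNge (ltnW h2).
  + case: (eqVneq (m1 z) z) => [e|/eqP hw]; first by rewrite e ffunE hz ltnNge h.
    rewrite ffunE (St_side sE s1 hw) hz i1 /=.
    case: (dich _ h) => [e|[e|h']].
    * move: h; rewrite e leqNgt rk_self; move/negP; case.
      by apply/sE/(St_edge s1).
    * have -> : m2 (m1 z) = z by rewrite e i2.
      by case: ifP.
    * by rewrite (St_opp2 sE s2 s1 h').
  + have hw := lt_matched h.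
    have h1 := St_opp1 sE s1 s2 h.
    by rewrite ffunE (St_side sE s1 hw) hz i1 ltnNge (ltnW h1).
  + case: (eqVneq (m2 z) z) => [e|/eqP hw]; first by rewrite e ffunE hz ltnNge h.
    rewrite ffunE (St_side sE s2 hw) hz i2 /=.
    case: (dich _ h) => [//|[e|h']].
    * have -> : m1 (m2 z) = z by rewrite -e i1.
      by case: ifP.
    * by rewrite (St_opp1 sE s2 s1 h').
- by move=> z; case: (meet_or m1 m2 z) => ->; [apply: (St_edge s1)|apply: (St_edge s2)].
- have key a b : E a b \/ E b a -> a \in X -> b \notin X ->
    rk a b < rk a (meet m1 m2 a) -> rk b a < rk b (meet m1 m2 b) -> False.
    move=> hE ha hb; rewrite (meetY _ _ hb) leq_min => h1 /andP[h2 h3].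
    case: (meet_or m1 m2 a) h1 => -> h1.
      by case: hE => hE; [apply: (St_nb s1 hE)|apply: (St_nb s1 hE)].
    by case: hE => hE; [apply: (St_nb s2 hE)|apply: (St_nb s2 hE)].
  move=> a b hE h1 h2; have := side_pref (sE _ _ hE).
  case ha : (a \in X) => /= hb.
    by apply: (key a b) => //; [left|rewrite hb].
  by apply: (key b a) => //; [right|rewrite ha].
Qed.

(** Maximise the total rank over [X]. The meet of the maximiser with any competitor is termwise at
    least as large there, so the two sums, and hence all their terms, agree. *)
Lemma extremal E (P : pred {ffun A -> A}) m0 : subT E ->
  (forall m1 m2, P m1 -> P m2 -> P (meet m1 m2)) -> St E m0 -> P m0 ->
  exists N, [/\ St E N, P N & forall m, St E m -> P m ->
     forall z, z \in X -> rk z (m z) <= rk z (N z)].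
Proof.
move=> sE hP sm0 Pm0.
have h0 : St E m0 && P m0 by rewrite sm0.
have [N /andP[sN PN] hN] :=
  @arg_maxnP _ m0 (fun m => St E m && P m) (fun m => \sum_(z in X) rk z (m z)) h0.
exists N; split => // m sm Pm z hz.
have := hN (meet m N); rewrite meet_St // hP // => /(_ isT).
have hle i : i \in X -> rk i (N i) <= rk i (meet m N i).
  by move=> hi; rewrite (meetX _ _ hi) leq_maxr.
rewrite /geq /= => hs.
have := @leqif_sum _ (fun z => z \in X) (fun i => rk i (N i) == rk i (meet m N i))
  (fun i => rk i (N i)) (fun i => rk i (meet m N i)).
case; first by move=> i hi; split=> //; apply: hle.
move=> h1 /esym; rewrite eqn_leq h1 hs => /forall_inP /(_ z hz) /eqP ->.
by rewrite (meetX _ _ hz) leq_maxl.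
Qed.

(** A trade: each [z] in [X] takes over the partner of [h z], and the inverse permutation tells the
    other side who its new partner is. *)
Definition swap N (h : {perm A}) : {ffun A -> A} :=
  [ffun z => if z \in X then N (h z) else (h^-1)%g (N z)].

Definition swappable N (h : {perm A}) :=
  forall z, h z <> z -> z \in X /\ N z <> z.

Lemma swappable_on N h : swappable N h -> perm_on [set z in X | N z != z] h.
Proof. by move=> H; apply/subsetP => z /eqP /H [h1 /eqP h2]; rewrite !inE h1. Qed.

Lemma swap_X N h z : swappable N h -> (h z \in X) = (z \in X).
Proof.
move=> H; case: (eqVneq (h z) z) => [->//|/eqP hz].
have [-> _] := H _ hz.
have : h z \in [set z in X | N z != z].
  by rewrite (perm_closed _ (swappable_on H)) inE; case: (H _ hz) => -> /eqP ->.
by rewrite inE => /andP[].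
Qed.

Lemma swap_matched N h z : swappable N h -> z \in X -> N z <> z -> N (h z) <> h z.
Proof.
move=> H hz hN.
have : h z \in [set z in X | N z != z].
  by rewrite (perm_closed _ (swappable_on H)) inE hz; apply/eqP.
by rewrite inE => /andP[_ /eqP].
Qed.

Lemma swap_unm N h z : swappable N h -> N z = z -> h z = z.
Proof. by move=> H hN; apply/eqP; apply: contraT => /eqP /H []. Qed.

Lemma swap_invol E N h : subT E -> St E N -> swappable N h -> involutive (swap N h).
Proof.
move=> sE sN H z; have iN := St_invol sN; rewrite [swap N h z]ffunE.
case hz : (z \in X).
  case: (eqVneq (N z) z) => [e|/eqP hN].
    by rewrite (swap_unm H e) e ffunE hz (swap_unm H e).
  have h1 := swap_matched H hz hN.
  by rewrite ffunE (St_side sE sN h1) (swap_X _ H) hz iN permK.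
case: (eqVneq (N z) z) => [e|/eqP hN].
  have e' : (h^-1)%g z = z by apply: (@perm_inj _ h); rewrite permKV (swap_unm H).
  by rewrite e e' ffunE hz e.
rewrite ffunE -(swap_X _ H) permKV (St_side sE sN hN) hz /=.
by rewrite iN.
Qed.

(** A blocking edge of the trade would already block [N]: a moved agent of [X] skips no neighbour on
    the way from its old partner to its new one, and the partners taken over do not lose. *)
Lemma swap_unblocked E N h : subT E -> symmetric E -> St E N -> swappable N h ->
  (forall a b, h a <> a -> E a b -> rk a b < rk a (N (h a)) -> rk a b <= rk a (N a)) ->
  (forall a, h a <> a -> rk (N (h a)) a <= rk (N (h a)) (h a)) ->
  forall a b, E a b -> rk a b < rk a (swap N h a) -> rk b a < rk b (swap N h b) -> False.
Proof.
move=> sE yE sN H h1 h2.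
have iN := St_invol sN.
have key a b : E a b -> a \in X ->
    rk a b < rk a (swap N h a) -> rk b a < rk b (swap N h b) -> False.
  move=> hE ha; have hb := side_pref (sE _ _ hE).
  rewrite !ffunE hb ha /= => l1 l2.
  have l1' : rk a b <= rk a (N a).
    by case: (eqVneq (h a) a) => [e|/eqP /h1]; [rewrite e in l1; apply: ltnW|apply].
  have l2' : rk b a < rk b (N b).
    apply: (leq_trans l2); set c := (h^-1)%g (N b).
    have ec : h c = N b by rewrite permKV.
    case: (eqVneq (h c) c) => [e|/eqP /h2]; first by rewrite -ec e.
    by rewrite ec iN.
  case: (eqVneq b (N a)) => [e|/eqP nb]; first by rewrite e iN ltnn in l2'.
  by apply: (St_nb sN hE) => //; apply: rk_lt_le => //; apply: sE.
move=> a b hE l1 l2; case ha : (a \in X); first exact: (key a b).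
by apply: (key b a) => //; [rewrite yE|rewrite (side_pref (sE _ _ hE)) ha].
Qed.

End Bipartite.

(** By opposite interests, the worst stable matching for the complement of [X] is the best one for
    [X]. *)
Lemma top_exists (A : finType) (T : instance A) (X : {set A}) (E : rel A) :
  marriage T X -> good T E -> exists2 N, St T E N &
    forall m, St T E m -> forall z, z \in X -> rk T z (N z) <= rk T z (m z).
Proof.
move=> mT gE; have [m0 s0] := good_ne gE.
have sE := good_sub gE.
have [N [sN _ hN]] := @extremal A T (~: X) (marriageC mT) E predT m0 sE (fun _ _ _ _ => isT) s0 isT.
exists N => // m sm z hz; rewrite leqNgt; apply/negP => h.
have h' := St_opp1 sE sm sN h.
have hw : m z \in ~: X by rewrite inE (St_side mT sE sm (lt_matched h)) hz.
have := hN m sm isT (m z) hw; rewrite (St_invol sm).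
by rewrite leqNgt h'.
Qed.

(** * Permutations from the cycles of a map *)

Section Cycle.
Variables (A : finType) (f : A -> A).

(** [f] may merge paths elsewhere, but it is injective on the orbit of a recurrent point; all other
    points are frozen. *)
Lemma cycle_perm x : fconnect f (f x) x ->
  exists h : {perm A}, forall z, h z = if fconnect f x z then f z else z.
Proof.
move=> hx.
have hc : fcycle f (orbit f x) by rewrite -fconnect_f.
pose g z := if fconnect f x z then f z else z.
have hi := inj_cycle hc.
have gi : injective g.
  move=> u v; rewrite /g; case: ifP => hu; case: ifP => hv.
  - by apply: hi; rewrite -fconnect_orbit.
  - by move=> e; rewrite -e (connect_trans hu) ?fconnect1 in hv.
  - by move=> e; rewrite e (connect_trans hv) ?fconnect1 in hu.
  - by [].
by exists (perm gi) => z; rewrite permE.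
Qed.

Lemma recurrent x : exists i, fconnect f (iter i.+1 f x) (iter i f x).
Proof.
have /trajectP[i hi e] := looping_order f x.
exists i; rewrite -e -(subnK hi) iterD; apply: fconnect_iter.
Qed.

End Cycle.

(** * Rotations of a stable table *)

Section Rotation.
Variables (A : finType) (T : instance A) (X : {set A}).
Hypothesis mT : marriage T X.
Variable E : rel A.
Hypothesis gE : good T E.
Implicit Types (m N : {ffun A -> A}).
Local Notation rk := (rk T).
Local Notation St := (St T).
Local Notation nx := (nx T E).
Let sE := good_sub gE.
Let yE := good_sym gE.

(** When [a] drops from [b] to its next neighbour [b'], the agent that [b'] lets go is the next
    worse neighbour of [b'] after [a]. In a stable table a rotation can therefore be read off the
    lists without knowing a matching that exposes it. *)
Definition sig (e : A * A) : A * A := (nx (nx e.1 e.2) e.1, nx e.1 e.2).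

Definition live (e : A * A) := [/\ e.1 \in X, E e.1 e.2 & nx e.1 e.2 <> e.1].

Definition above (e : A * A) m := rk e.1 (m e.1) <= rk e.1 e.2.

(** With [b'] and [a'] as in the successor edge, a chain of equivalences: [a] has [b] or better iff
    it does strictly better than [b'], iff [b'] does strictly worse than [a], iff [b'] has [a'] or
    worse, iff [a'] has [b'] or better. The outer two skip to an adjacent neighbour, the inner two
    are [edge_opp]. A stable matching through [a b'] violates the first condition, hence the last,
    so [a'] has a further neighbour and the walk continues. *)
Lemma sig_step e : live e ->
  [/\ rk (sig e).2 e.1 < rk (sig e).2 (sig e).1, live (sig e) &
      forall m, St E m -> above e m = above (sig e) m].
Proof.
case: e => a b [/= ha hab hn]; rewrite /sig /above /=.
set b' := nx a b in hn *; set a' := nx b' a.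
have [hab' l1 hmin] := nxP sE hn.
rewrite -/b' in hab' l1 hmin.
have hn' : a' <> b'.
  have [m sm e] := good_st gE hab.
  have h : rk a (m a) < rk a b' by rewrite e.
  rewrite (edge_opp gE sm hab') in h.
  apply: (nx_neq sE _ h).
  by apply: (edge_partner gE sm); rewrite yE; exact: hab'.
have [hba' l2 hmin'] := nxP sE hn'.
rewrite -/a' in hba' l2 hmin'.
have hA m : St E m -> (rk a (m a) <= rk a b) = (rk a' (m a') <= rk a' b').
  move=> sm.
  have -> : (rk a (m a) <= rk a b) = (rk a (m a) < rk a b').
    apply/idP/idP => h; first exact: leq_ltn_trans h l1.
    rewrite leqNgt; apply/negP => h'.
    have := hmin _ (edge_partner gE sm hab) h'.
    by rewrite leqNgt h.
  rewrite (edge_opp gE sm hab').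
  rewrite [RHS]leqNgt -(edge_opp gE sm hba') -leqNgt.
  apply/idP/idP => h; last exact: leq_trans h.
  by apply: hmin' => //; apply: (edge_partner gE sm hba').
split => //; split => //=.
- by rewrite (side_pref mT (sE hba')) (side_pref mT (sE hab')) negbK.
- by rewrite yE.
have [m sm e] := good_st gE hab'.
have := hA m sm; rewrite e leqNgt l1 /= => /esym/negbT; rewrite -ltnNge => h.
by apply: (nx_neq sE _ h); apply: (edge_partner gE sm); rewrite yE; exact: hba'.
Qed.

Variable e0 : A * A.
Hypothesis l0 : live e0.

Lemma walk_live i : live (iter i sig e0).
Proof. by elim: i => //= i /sig_step []. Qed.

Lemma walk_above i m : St E m -> above (iter i sig e0) m = above e0 m.
Proof. by move=> sm; elim: i => //= i <-; case: (sig_step (walk_live i)) => _ _ ->. Qed.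

(* The [X]-worst stable matching above [e0] contains the whole rotation. *)
Lemma walk_matching : exists2 N, St E N & forall i, N (iter i sig e0).1 = (iter i sig e0).2.
Proof.
have [hX hE _] := l0.
have [m0 s0 em] := good_st gE hE.
have [||N [sN PN hN]] := @extremal A T X mT E (above e0) m0 sE _ s0.
- by move=> m1 m2; rewrite /above; case: (meet_or T X m1 m2 e0.1) => ->.
- by rewrite /above em.
exists N => // i; have := walk_above i sN; rewrite PN => h.
have [hX' hE' _] := walk_live i.
have [m sm e] := good_st gE hE'.
apply/esym; apply: (rk_inj (sE hE')); apply/eqP; rewrite eqn_leq -{1}e.
apply/andP; split; last exact: h.
by apply: hN => //; rewrite -(walk_above i) // /above e.
Qed.

Variable N : {ffun A -> A}.
Hypothesis sN : St E N.
Hypothesis hN : forall i, N (iter i sig e0).1 = (iter i sig e0).2.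

(** The walk on edges seen from its [X] ends: once [N] contains the whole walk, the first component
    of an edge determines the second. *)
Definition succ (z : A) := N (nx z (N z)).

Lemma walk_succ i : (iter i.+1 sig e0).1 = succ (iter i sig e0).1.
Proof.
by rewrite /succ hN; apply: (can_inj (St_invol sN)); rewrite hN (St_invol sN).
Qed.

Lemma walk_iter i : (iter i sig e0).1 = iter i succ e0.1.
Proof. by elim: i => // i IH; rewrite walk_succ IH. Qed.

Lemma walk_move i (z := (iter i sig e0).1) :
  [/\ z \in X, N z <> z, rk z (N z) < rk z (nx z (N z)) &
      rk (nx z (N z)) z < rk (nx z (N z)) (succ z)].
Proof.
have [h1 _ _] := sig_step (walk_live i).
have [hX hE hn] := walk_live i; rewrite /z; split => //.
- by rewrite hN; apply/pref_neq/(sE hE).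
- by rewrite hN; case: (nxP sE hn).
- by rewrite -walk_succ hN.
Qed.

Lemma walk_between i b (z := (iter i sig e0).1) :
  E z b -> rk z b < rk z (nx z (N z)) -> rk z b <= rk z (N z).
Proof.
move=> hb h; rewrite leqNgt; apply/negP => h'.
have [_ _ hn] := walk_live i; rewrite -hN in hn.
by have [_ _ /(_ _ hb h')] := nxP sE hn; rewrite leqNgt h.
Qed.

End Rotation.

(** * Adding one edge strictly between neighbours *)

Section Mid.
Variables (A : finType) (T : instance A) (X : {set A}).
Hypothesis mT : marriage T X.
Variable E : rel A.
Hypothesis gE : good T E.
Implicit Types (m N : {ffun A -> A}).
Local Notation rk := (rk T).
Local Notation St := (St T).
Local Notation nx := (nx T E).
Let sE := good_sub gE.
Let yE := good_sym gE.
Variables x y : A.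
Hypotheses (hx : x \in X) (hxy : y \in pref T x) (nE : ~~ E x y).

Definition start : A * A := (nx y x, y).

Definition hit (e : A * A) : bool :=
  [&& e.1 == x, rk x e.2 < rk x y & rk x y < rk x (nx x e.2)].

Definition addE (u v : A) : bool :=
  [|| E u v, (u == x) && (v == y) | (u == y) && (v == x)].

(** The condition that [edge_opp] would impose on [x y] as an edge: [x] wants to switch exactly when
    [y] prefers to keep its partner. *)
Definition consistent (F : rel A) :=
  forall m, St F m -> (rk x y < rk x (m x)) = (rk y (m y) < rk y x).

Let hyx : x \in pref T y. Proof. by rewrite -pref_sym. Qed.

Lemma start_live : nx y x <> y -> nx (nx y x) y <> nx y x -> live T X E start.
Proof.
move=> h1 h2; have [h3 h4 _] := nxP sE h1.
split=> //=; last by rewrite yE.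
by rewrite (side_pref mT (sE h3)) (side_pref mT hxy) negbK.
Qed.

(** No neighbour of [y] ranks between [x] and [nx y x], and [x] is not a neighbour itself, so for
    [y] doing better than [nx y x] and doing better than [x] are the same. *)
Lemma start_below m : nx y x <> y -> St E m ->
  ~~ above T start m = (rk y (m y) < rk y x).
Proof.
move=> h1 sm; have [h3 h4 hmin] := nxP sE h1.
rewrite /above /= -ltnNge -(edge_opp gE sm h3).
apply/idP/idP => h; last exact: ltn_trans h h4.
rewrite ltnNge; apply/negP => h'.
have hm := edge_partner gE sm h3.
have : rk y x < rk y (m y).
  apply: rk_lt_le => // e; move: nE; by rewrite yE e hm.
by move/(hmin _ hm); rewrite leqNgt h.
Qed.

(** Leaving the rotation of [start] carries [y] across the place of [x]. Consistency demands that
    [x] cross the place of [y] at the same moment, so [x] must be on that rotation. *)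
Lemma hit_of_consistent : consistent E ->
  (exists2 u, E y u & rk y x < rk y u) ->
  (exists2 m, St E m & rk y (m y) < rk y x) ->
  [/\ nx y x <> y, nx (nx y x) y <> nx y x &
      exists2 i, i < #|A| & hit (iter i (sig T E) start)].
Proof.
move=> hc [u hu1 hu2] [m1 sm1 hm1].
have n1 : nx y x <> y by apply: nx_neq hu2.
have [hE0 l0 _] := nxP sE n1.
have n2 : nx (nx y x) y <> nx y x.
  have := start_below n1 sm1; rewrite hm1 /above /= -ltnNge => h.
  by apply: (nx_neq sE _ h); apply: (edge_partner gE sm1); rewrite yE; exact: hE0.
split=> //; have lv := start_live n1 n2.
have [N sN hN] := walk_matching mT gE lv.
have ef := walk_iter sN hN.
set f := succ T E N in ef.
have Ny : N y = nx y x by apply: (can_inj (St_invol sN)); rewrite (St_invol sN) (hN 0).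
have Nx : rk x (N x) <= rk x y.
  by rewrite leqNgt (hc _ sN) Ny -leqNgt ltnW.
(* If the walk missed [x], trading along the cycle it runs into would give a stable matching that is
   not above [start]: [y] now does better than [x], while [x] still has [N x], which it prefers to
   [y]. This contradicts consistency. *)
have cx : fconnect f start.1 x.
  case cx : (fconnect f start.1 x) => //; exfalso.
  have [i hi] := recurrent f start.1.
  set c := iter i f start.1 in hi.
  have [h hh] := cycle_perm hi.
  have orb z : fconnect f c z -> exists j, z = (iter j (sig T E) start).1.
    move/iter_findex => <-; exists (findex f c z + i); by rewrite ef iterD.
  have hs : swappable X N h.
    move=> z; rewrite hh; case: ifP => // /orb[j ->] _.
    by case: (walk_move mT gE lv sN hN j).
  have sM : St E (swap X N h).
    apply/StP; split.
    - exact: (swap_invol mT sE sN).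
    - have hr z : z \in X -> swap X N h z <> z -> E z (swap X N h z).
        move=> hz; rewrite ffunE hz hh; case: ifP; last by move=> _; apply: (St_edge sN).
        move=> /orb[j ->] _; rewrite /f /succ (St_invol sN) hN.
        by have [_ _ hn] := walk_live mT gE lv j; case: (nxP sE hn).
      move=> z hz; case zX : (z \in X); first exact: hr.
      have iv := swap_invol mT sE sN hs.
      have [eN|/eqP nN] := eqVneq (N z) z.
        case: hz; rewrite ffunE zX eN; apply: (@perm_inj _ h).
        by rewrite permKV (swap_unm hs).
      rewrite yE -{2}[z]iv; apply: hr; last by rewrite iv => /esym.
      by rewrite ffunE zX -(swap_X _ hs) permKV (St_side mT sE sN nN) zX.
    - apply: (swap_unblocked mT sE yE sN hs).
        move=> a b; rewrite hh; case: ifP => // /orb[j ->] _.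
        rewrite /f /succ (St_invol sN); exact: (walk_between mT gE lv hN).
      move=> a; rewrite hh; case: ifP => // /orb[j ->] _.
      rewrite /f /succ (St_invol sN); apply: ltnW.
      by case: (walk_move mT gE lv sN hN j).
  have nA : ~~ above T start (swap X N h).
    rewrite -(walk_above mT gE lv i sM) /above ef -/c -hN ef -/c -ltnNge ffunE.
    have ci : c = (iter i (sig T E) start).1 by rewrite ef.
    rewrite hh connect0 /f /succ (St_invol sN) ci.
    by case: (walk_move mT gE lv sN hN i) => -> _ + _; rewrite hN.
  move: nA; rewrite start_below // -(hc _ sM) ffunE hx hh.
  suff -> : fconnect f c x = false by rewrite ltnNge Nx.
  by apply/negP => hcx; rewrite (connect_trans (fconnect_iter f i start.1) hcx) in cx.
exists (findex f start.1 x).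
  exact: leq_trans (findex_max cx) (max_card _).
set i := findex f start.1 x.
have ei : (iter i (sig T E) start).1 = x by rewrite ef iter_findex.
have [_ hEi hn] := walk_live mT gE lv i.
have [hb hl _] := nxP sE hn.
rewrite /hit -hN ei eqxx /=; rewrite ei in hEi hb hl hn; rewrite -ei hN ei in (Nx) *.
apply/andP; split.
  by apply: rk_lt_le => //; [exact: sE|move=> e; rewrite e (negbTE nE) in hEi].
(* For the other half of [hit], a stable matching giving [x] its next neighbour is below the walk,
   so [y] does better than [x] there and consistency makes [x] prefer [y] to that neighbour. *)
have [m sm em] := good_st gE hb.
rewrite -em (hc _ sm) -start_below // -(walk_above mT gE lv i sm) /above ei em.
by rewrite -ltnNge.
Qed.

(** Old stable matchings survive because [above] is constant on the walk: if [y] does worse than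
    [x], the matching is above [start], hence above the edge at [x], and [x] does better than
    [y]. *)
Lemma hit_good i : nx y x <> y -> nx (nx y x) y <> nx y x ->
  hit (iter i (sig T E) start) ->
  good T addE /\ forall m, St E m -> St addE m.
Proof.
move=> n1 n2 /and3P[/eqP ei h1 h2].
have lv := start_live n1 n2.
have [hE0 l0 _] := nxP sE n1.
have [N sN hN] := walk_matching mT gE lv.
have ef := walk_iter sN hN.
set f := succ T E N in ef.
have eb : (iter i (sig T E) start).2 = N x by rewrite -hN ei.
rewrite eb in h1 h2.
have btw b : E x b -> rk x b < rk x y -> rk x b <= rk x (N x).
  move=> hb hl; have := @walk_between _ _ _ mT _ gE _ lv _ hN i b; rewrite ei; apply => //.
  exact: ltn_trans hl h2.
have mono m : St E m -> St addE m.
  move=> sm; apply/StP; split; first exact: (St_invol sm).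
    by move=> z hz; rewrite /addE (St_edge sm hz).
  have nb : rk x y < rk x (m x) -> rk y x < rk y (m y) -> False.
    move=> g1 g2; have := start_below n1 sm; rewrite [RHS]ltnNge (ltnW g2) => /negbFE.
    rewrite -(walk_above mT gE lv i sm) /above ei eb => g3.
    have := ltn_trans (leq_ltn_trans g3 h1) g1; by rewrite ltnn.
  move=> a b /or3P[hE|/andP[/eqP-> /eqP->]|/andP[/eqP-> /eqP->]] //.
    exact: (St_nb sm hE).
  by move=> g1 g2; apply: nb.
split=> //.
have yA : symmetric addE.
  by move=> u v; rewrite /addE yE; congr orb; rewrite orbC andbC [(u == x) && _]andbC.
have sA : subT T addE.
  by move=> u v /or3P[/sE//|/andP[/eqP-> /eqP->]|/andP[/eqP-> /eqP->]].
suff [M sM eM] : exists2 M, St addE M & M x = y.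
  split=> //; last by exists M.
  move=> a b /or3P[hE|/andP[/eqP-> /eqP->]|/andP[/eqP-> /eqP->]].
  - by have [m sm e] := good_st gE hE; exists m => //; apply: mono.
  - by exists M.
  - by exists M => //; rewrite -eM (St_invol sM).
(* Close the part of the walk leading from [nx y x] to [x] into a cycle. *)
pose g z := if z == x then start.1 else f z.
have ex : exists j, iter j f start.1 == x by exists i; rewrite -ef ei.
(* Up to the first visit to [x], the redirected map [g] agrees with [f]. *)
have [j /eqP ej hj] := ex_minnP ex.
have gj k : k <= j -> iter k g start.1 = iter k f start.1.
  elim: k => //= k IH hk; rewrite IH ?(ltnW hk) // /g; case: eqP => // e.
  by move: (hj k); rewrite e eqxx leqNgt hk => /(_ isT).
have grec : fconnect g (g start.1) start.1.
  have : iter j.+1 g start.1 = start.1 by rewrite /= gj // ej /g eqxx.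
  by rewrite iterSr => {2}<-; apply: fconnect_iter.
have cgx : fconnect g start.1 x by rewrite -ej -gj //; apply: fconnect_iter.
have [h hh] := cycle_perm grec.
have orb z : fconnect g start.1 z -> exists k, z = (iter k (sig T E) start).1.
  move/iter_findex => <-; elim: (findex _ _ _) => [|k [k' e]]; first by exists 0.
  rewrite iterS e /g; case: eqP => _; first by exists 0.
  by exists k'.+1; rewrite (walk_succ sN hN).
have hxx : h x = start.1 by rewrite hh cgx /g eqxx.
have Nst : N start.1 = y by rewrite (hN 0).
have hs : swappable X N h.
  move=> z; rewrite hh; case: ifP => // /orb[k ->] _.
  by case: (walk_move mT gE lv sN hN k).
have hrest a : h a <> a -> a <> x -> exists2 k, a = (iter k (sig T E) start).1 & h a = f a.
  by rewrite hh; case: ifP => // /orb[k ->] _; rewrite /g; case: eqP => // _ _; exists k.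
have Mx : swap X N h x = y by rewrite ffunE hx hxx Nst.
have iv := swap_invol mT sE sN hs.
exists (swap X N h) => //; apply/StP; split => //.
- have hr z : z \in X -> swap X N h z <> z -> addE z (swap X N h z).
    move=> hz; have [->|/eqP zx] := eqVneq z x.
      by rewrite Mx /addE !eqxx orbT.
    rewrite ffunE hz; have [->|/eqP nh] := eqVneq (h z) z.
      by move=> hzz; rewrite /addE (St_edge sN hzz).
    have [k ek ->] := hrest _ nh zx.
    rewrite /addE /f /succ (St_invol sN) ek hN.
    by have [_ _ hn] := walk_live mT gE lv k; case: (nxP sE hn) => ->.
  move=> z hz; case zX : (z \in X); first exact: hr.
  have [eN|/eqP nN] := eqVneq (N z) z.
    case: hz; rewrite ffunE zX eN; apply: (@perm_inj _ h).
    by rewrite permKV (swap_unm hs).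
  rewrite yA -{2}[z]iv; apply: hr; last by rewrite iv => /esym.
  by rewrite ffunE zX -(swap_X _ hs) permKV (St_side mT sE sN nN) zX.
- have nb : forall a b, E a b ->
      rk a b < rk a (swap X N h a) -> rk b a < rk b (swap X N h b) -> False.
    (* At [x] the trade leads from [N x] down to [y], and [hit] leaves no neighbour between them;
       [y] in turn gains by exchanging [nx y x] for [x]. *)
    apply: (swap_unblocked mT sE yE sN hs).
      move=> a b nh; have [->|/eqP ax] := eqVneq a x.
        by rewrite hxx Nst; apply: btw.
      have [k -> ->] := hrest _ nh ax; rewrite /f /succ (St_invol sN).
      exact: (walk_between mT gE lv hN).
    move=> a nh; have [->|/eqP ax] := eqVneq a x.
      by rewrite hxx Nst; apply: ltnW.
    have [k -> ->] := hrest _ nh ax; rewrite /f /succ (St_invol sN); apply: ltnW.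
    by case: (walk_move mT gE lv sN hN k).
  move=> a b /or3P[hE|/andP[/eqP-> /eqP->]|/andP[/eqP-> /eqP->]].
  + exact: nb.
  + by rewrite Mx ltnn.
  + by rewrite Mx => _; rewrite ltnn.
Qed.

End Mid.

(** * Top trading cycles *)

Section Eventual.
Variables (A : finType) (f : A -> A) (L : {set A}).
Hypothesis fL : forall x, x \in L -> f x \in L.

(** The agents on cycles of [f]: after [#|A|] steps every path has entered its cycle, and the images
    of a whole cycle cover it. No cycle detection is involved, and all cycles of a round trade at
    once. *)
Definition eventual : {set A} := [set iter #|A| f x | x in L].

Let Lk k := [set iter k f x | x in L].

Let Lk_step k : Lk k.+1 = f @: Lk k.
Proof. by rewrite /Lk -imset_comp; apply: eq_imset. Qed.

Lemma iter_in k x : x \in L -> iter k f x \in L.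
Proof. by move=> hx; elim: k => //= k /fL. Qed.

Let Lk_sub k : Lk k.+1 \subset Lk k.
Proof.
apply/subsetP => _ /imsetP[x hx ->]; apply/imsetP; exists (f x); first exact: fL.
by rewrite iterSr.
Qed.

(* A decreasing chain of sets is stationary after [#|A|] steps. *)
Let Lk_stat k : Lk k.+1 = Lk k \/ #|Lk k| + k <= #|A|.
Proof.
elim: k => [|k IH]; first by right; rewrite addn0 max_card.
case: (eqVneq (Lk k.+1) (Lk k)) => [e|ne]; first by left; rewrite Lk_step e -Lk_step.
case: IH => [e|IH]; first by rewrite e eqxx in ne.
right; rewrite addnS; apply: leq_trans IH; rewrite ltn_add2r.
by apply: proper_card; rewrite properEneq ne Lk_sub.
Qed.

Lemma eventual_im : f @: eventual = eventual.
Proof.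
rewrite -/(Lk #|A|) -Lk_step; case: (Lk_stat #|A|) => //.
rewrite -[X in _ <= X]add0n leq_add2r leqn0 cards_eq0 => /eqP e.
by rewrite Lk_step e imset0.
Qed.

Lemma eventual_in x : x \in eventual -> f x \in eventual.
Proof. by move=> h; rewrite -eventual_im imset_f. Qed.

Lemma eventual_inj : {in eventual &, injective f}.
Proof. by apply/imset_injP; rewrite eventual_im. Qed.

Lemma eventual_sub x : x \in eventual -> x \in L.
Proof. by case/imsetP => z hz ->; apply: iter_in. Qed.

End Eventual.

(** Draw an arc from [x] to the owner [N y] whenever [x] would gain and [y] would lose from being
    matched. [tm] strictly decreases along arcs, so no cyclic trade of this kind exists. *)
Definition acyclic_over (A : finType) (T : instance A) (S : {set A})
    (N : {ffun A -> A}) (tm : A -> nat) :=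
  forall x y, x \in S -> N x <> x -> N y <> y -> rk T x y < rk T x (N x) ->
    rk T y (N y) < rk T y x -> tm (N y) < tm x.

Section Trading.
Variables (A : finType) (T : instance A) (S : {set A}).
Hypothesis mT : marriage T S.
Variable E : rel A.
Hypothesis gE : good T E.
Implicit Types (m N : {ffun A -> A}).
Local Notation rk := (rk T).
Local Notation St := (St T).
Let sE := good_sub gE.
Let yE := good_sym gE.
Variable N0 : {ffun A -> A}.
Hypothesis s0 : St E N0.
Hypothesis top0 : forall m, St E m -> forall z, z \in S -> rk z (N0 z) <= rk z (m z).
Let i0 := St_invol s0.

Definition up x y := (rk x y < rk x (N0 x)) && (rk y (N0 y) < rk y x).

(** Keeping one's own partner is always allowed, so every agent still trading has a favourite. *)
Definition cand (L : {set A}) x y := (N0 y \in L) && ((y == N0 x) || up x y).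

Definition fav L x := sel T x (cand L x).

Definition point L x := N0 (fav L x).

(* After [r] rounds, [L] is the set of agents still trading, [N0 \o h] the matching
   given to those who left, and [tm] the round in which they left. *)
Record trading (L : {set A}) (h : {perm A}) (tm : A -> nat) (r : nat) : Prop := Trading {
  tr_L : forall x, x \in L -> x \in S /\ N0 x <> x;
  tr_h : forall z, h z <> z -> [/\ z \in S, N0 z <> z & z \notin L];
  tr_up : forall x, x \in S -> N0 x <> x -> x \notin L ->
            N0 (h x) = N0 x \/ up x (N0 (h x));
  tr_tm : forall x, x \in S -> N0 x <> x -> x \notin L -> tm (h x) = tm x /\ tm x < r;
  tr_max : forall x y, x \in S -> N0 x <> x -> x \notin L -> N0 y <> y ->
            up x y -> rk x y < rk x (N0 (h x)) -> N0 y \notin L /\ tm (N0 y) < tm x;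
  tr_card : #|L| + r <= #|A| \/ L = set0 }.

Lemma cand_pref L x y : N0 x <> x -> cand L x y -> y \in pref T x.
Proof.
move=> hx /andP[_ /orP[/eqP->|/andP[/rk_ltW//]]].
exact/sE/(St_edge s0).
Qed.

Lemma favP (L : {set A}) x : (forall x, x \in L -> x \in S /\ N0 x <> x) -> x \in L ->
  [/\ cand L x (fav L x), fav L x <> x &
      forall y, cand L x y -> rk x (fav L x) <= rk x y].
Proof.
move=> hL hx; have [_ nx] := hL _ hx.
apply: (@selP _ T x (cand L x) (N0 x)); first by move=> w; apply: cand_pref.
by rewrite /cand i0 hx eqxx.
Qed.

Lemma trading_init :
  trading [set x in S | N0 x != x] 1%g (fun _ => 0) 0.
Proof.
split.
- by move=> x; rewrite inE => /andP[-> /eqP].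
- by move=> z; rewrite perm1.
- by move=> x h1 /eqP h2; rewrite inE h1 h2.
- by move=> x h1 /eqP h2; rewrite inE h1 h2.
- by move=> x y h1 /eqP h2; rewrite inE h1 h2.
- by left; rewrite addn0 max_card.
Qed.

Lemma trading_round L h tm r (C := eventual (point L) L) : trading L h tm r ->
  exists h' tm', [/\ trading (L :\: C) h' tm' r.+1,
    forall x, x \in C -> N0 (h' x) = fav L x & forall x, x \notin C -> h' x = h x].
Proof.
case=> hL hh hup htm hmax hcard.
pose f := point L.
have fL x : x \in L -> f x \in L.
  by move=> hx; case: (favP hL hx) => /andP[].
have fC x : x \in C -> f x \in C := @eventual_in _ _ _ fL x.
have iC : {in C &, injective f} := eventual_inj fL.
have CL x : x \in C -> x \in L := @eventual_sub _ _ _ fL x.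
pose g z := if z \in C then f z else h z.
have hC v : v \notin C -> h v \notin C.
  case: (eqVneq (h v) v) => [->//|/eqP nv] hv; apply/negP => /CL hl.
  have : h (h v) <> h v by move/perm_inj.
  by case/hh => _ _; rewrite hl.
have gi : injective g.
  move=> u v; rewrite /g; case: ifP => hu; case: ifP => hv.
  - exact: iC.
  - by move=> e; move: (hC v); rewrite -e fC // hv => /(_ isT).
  - by move=> e; move: (hC u); rewrite e fC // hu => /(_ isT).
  - exact: perm_inj.
exists (perm gi), (fun z => if z \in C then r else tm z); split; last first.
- by move=> x /negbTE hx; rewrite permE /g hx.
- by move=> x hx; rewrite permE /g hx /f /point i0.
split.
- by move=> x /setDP[/hL].
- move=> z; rewrite permE /g !inE; case: ifP => hz; first by have [] := hL _ (CL _ hz).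
  by case/hh => ? ? /negbTE ->.
- move=> x h1 h2; rewrite permE /g !inE; case: ifP => hx /=.
    move=> _; rewrite /f /point i0; case: (favP hL (CL _ hx)) => /andP[_ /orP[/eqP|]] *.
      by left.
    by right.
  by move=> h3; apply: hup.
- move=> x h1 h2; rewrite permE /g !inE; case hx : (x \in C) => /= h3; first by rewrite fC.
  have := hC x; rewrite hx => /(_ isT) /negbTE ->.
  by have [-> h4] := htm _ h1 h2 h3; split=> //; apply: ltnW.
- move=> x y h1 h2; rewrite permE /g !inE.
  case hx : (x \in C) => /= h3 hy hu.
    rewrite /f /point i0 => hlt.
    (* The favourite is best among the candidates, so a preferred [y] was no candidate: its owner
       had left before this round. *)
    have nL : N0 y \notin L.
      apply/negP => hl; have [_ _ /(_ y)] := favP hL (CL _ hx).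
      by rewrite /cand hl hu orbT leqNgt hlt => /(_ isT).
    have -> : (N0 y \in C) = false by apply/negP => /CL; rewrite (negbTE nL).
    rewrite (negbTE nL); split=> //.
    have h5 : N0 (N0 y) <> N0 y by rewrite i0; apply/nesym.
    have yp : y \in pref T x by case/andP: hu => /rk_ltW.
    have h6 : N0 y \in S.
      by rewrite (St_side mT sE s0 hy) (side_pref mT yp) h1.
    by have [] := htm _ h6 h5 nL.
  move=> hlt; have [nL hlt'] := hmax _ _ h1 h2 h3 hy hu hlt.
  have -> : (N0 y \in C) = false by apply/negP => /CL; rewrite (negbTE nL).
  by rewrite (negbTE nL).
- case: (set_0Vmem L) => [->|[x hx]]; first by right; rewrite set0D.
  case: hcard => [hcard|e]; last by rewrite e inE in hx.
  left; rewrite addnS; apply: leq_trans hcard; rewrite ltn_add2r.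
  apply: proper_card; apply/properP; split; first exact: subsetDl.
  exists (iter #|A| f x); first exact: iter_in.
  rewrite inE negb_and negbK; apply/orP; left; apply/imsetP; by exists x.
Qed.

Definition addM (M : {ffun A -> A}) u v := E u v || ((M u == v) && (M u != u)).

(** No edge of [E] blocks the new matching, since each agent of [S] has at least its optimal
    partner. If a new edge blocked an old stable matching, its end outside [S] would do worse there
    than in [N0], so by opposite interests its [N0]-partner would do better than in [N0], which is
    optimal for [S]. *)
Lemma trading_end h tm : trading set0 h tm #|A| ->
  let M := swap S N0 h in
  [/\ good T (addM M), forall m, St E m -> St (addM M) m, St (addM M) M &
      acyclic_over T S M tm].
Proof.
case=> _ hh hup htm hmax _ M.
have hs : swappable S N0 h by move=> z /hh[].
have hM x : x \in S -> M x = N0 (h x) by move=> hx; rewrite /M ffunE hx.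
have iM : involutive M by apply: (swap_invol mT sE s0 hs).
have nM x : x \in S -> N0 x = x -> M x = x.
  by move=> hx e; rewrite hM // (swap_unm hs e) e.
have MupX x : x \in S -> M x = N0 x \/ up x (M x).
  move=> hx; rewrite hM //; have [e|/eqP ne] := eqVneq (N0 x) x.
    by left; rewrite (swap_unm hs e).
  by apply: hup => //; rewrite inE.
have Mle x : x \in S -> rk x (M x) <= rk x (N0 x).
  by case/MupX => [->//|/andP[/ltnW]].
have Mge x : x \in S -> rk (M x) (N0 (M x)) <= rk (M x) x.
  move=> hx; case: (MupX _ hx) => [->|/andP[_ /ltnW //]]; by rewrite i0.
have MY z : z \notin S -> M z <> z -> M z \in S.
  move=> hz; rewrite /M ffunE (negbTE hz) -(swap_X _ hs) permKV => h1.
  rewrite (St_side mT sE s0) // => e; apply: h1; rewrite e.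
  by apply: (@perm_inj _ h); rewrite permKV (swap_unm hs).
have MP x : x \in S -> M x <> x -> M x \in pref T x.
  move=> hx hne; case: (MupX _ hx) => [e|/andP[/rk_ltW//]].
  by rewrite e; apply/sE/(St_edge s0); rewrite -e.
have MPa z : M z <> z -> M z \in pref T z.
  move=> hz; case hzS : (z \in S); first exact: MP.
  have h1 := MY _ (negbT hzS) hz.
  by rewrite pref_sym -{1}[z]iM; apply: MP => //; rewrite iM => /esym.
have yA : symmetric (addM M).
  move=> u v; rewrite /addM yE; congr orb; apply/andP/andP => -[/eqP<- h1];
  by rewrite iM eqxx eq_sym.
have sA : subT T (addM M).
  by move=> u v /orP[/sE//|/andP[/eqP<- /eqP/MPa]].
have topE a b : E a b -> a \in S -> rk a (N0 a) <= rk a b.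
  by move=> hE ha; have [m sm <-] := good_st gE hE; apply: top0.
have sM : St (addM M) M.
  apply/StP; split => //; first by move=> z hz; rewrite /addM eqxx (introN eqP hz) orbT.
  have key a b : E a b -> a \in S -> rk a b < rk a (M a) -> False.
    by move=> hE ha; rewrite ltnNge (leq_trans (Mle _ ha)) ?topE.
  move=> a b /orP[hE|/andP[/eqP <- _]]; last by rewrite ltnn.
  case ha : (a \in S) => h1 h2; first exact: (key a b).
  by apply: (key b a) h2; rewrite ?(side_pref mT (sE hE)) ?ha // yE.
have mono m : St E m -> St (addM M) m.
  move=> sm; apply/StP; split; first exact: (St_invol sm).
    by move=> z hz; rewrite /addM (St_edge sm hz).
  have key a : a \in S -> M a <> a -> rk (M a) a < rk (M a) (m (M a)) -> False.
    move=> ha hne h1; have h2 := leq_ltn_trans (Mge _ ha) h1.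
    have h3 := St_opp1 sE s0 sm h2.
    have h4 : N0 (M a) \in S.
      by rewrite (St_side mT sE s0 (lt_matched h2)) (side_pref mT (MP _ ha hne)) ha.
    by move: (top0 sm h4); rewrite i0 leqNgt h3.
  move=> a b /orP[hE|/andP[/eqP <- /eqP hne]]; first exact: (St_nb sm hE).
  case ha : (a \in S) => h1 h2; first exact: (key a).
  have hb := MY _ (negbT ha) hne.
  apply: (key (M a) hb); first by rewrite iM => /esym.
  by rewrite iM.
split=> //.
  split=> //; last by exists M.
  move=> a b /orP[hE|/andP[/eqP <- _]]; last by exists M.
  by have [m sm e] := good_st gE hE; exists m => //; apply: mono.
move=> x y hx hxx hy h1 h2.
have yp : y \in pref T x := rk_ltW h1.
have hyS : y \notin S by rewrite (side_pref mT yp) hx.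
have h3 := MY _ hyS hy.
have h4 : rk y (N0 y) <= rk y (M y) by have := Mge _ h3; rewrite iM.
have hux : up x y.
  by rewrite /up (leq_trans h1 (Mle _ hx)) (leq_ltn_trans h4 h2).
have My : h (M y) = N0 y by rewrite /M ffunE (negbTE hyS) permKV.
have nM' z : z \in S -> M z <> z -> N0 z <> z by move=> hz hne /(nM _ hz).
have h5 : N0 (M y) <> M y by apply: nM' => //; rewrite iM => /esym.
have ny : N0 y <> y by rewrite -My => e; move: h3; rewrite -(swap_X _ hs) e (negbTE hyS).
(* [tm] is constant along [h], so the owners of [y] in the old and in the new matching left in the
   same round. *)
have [] := htm _ h3 h5; rewrite ?inE // => <- _; rewrite My.
have [] := hmax x y hx (nM' _ hx hxx) _ ny hux; rewrite ?inE //.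
by rewrite -hM.
Qed.

End Trading.

(** * A criterion for internal closedness *)

Section Closure.
Variables (A : finType) (T : instance A).
Implicit Types (E : rel A) (m N : {ffun A -> A}).
Local Notation rk := (rk T).
Local Notation St := (St T).

(** Induction on [tm]. If [x] gains by moving to [m x], then [m x] loses, so there is an arc to its
    owner in [N]; by opposite interests the owner gains from [m] too, but it left earlier. *)
Lemma acyclic_no_up E (S : {set A}) N tm m : marriage T S -> subT T E ->
  St E N -> acyclic_over T S N tm -> St E m ->
  forall x, x \in S -> rk x (N x) <= rk x (m x).
Proof.
move=> mT sE sN hN sm x.
elim: {x}(tm x).+1 {-2}x (ltnSn (tm x)) => // k IH x; rewrite ltnS => hk hx.
rewrite leqNgt; apply/negP => h.
have h1 := St_opp1 sE sm sN h.
have h2 := lt_matched h1.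
have yp : m x \in pref T x := rk_ltW h.
have nx : N x <> x.
  by move=> e; have := St_opp2 sE sm sN h; rewrite e ltnNge rk_max.
have h3 := hN _ _ hx nx h2 h h1.
have h4 : N (m x) \in S by rewrite (St_side mT sE sN h2) (side_pref mT yp) hx.
have := IH _ (leq_trans h3 hk) h4; rewrite (St_invol sN) leqNgt.
have {}h1 : rk (m x) (N (m x)) < rk (m x) (m (m x)) by rewrite (St_invol sm).
by rewrite (St_opp1 sE sN sm h1).
Qed.

Variables (X : {set A}) (E : rel A) (N0 N1 : {ffun A -> A}) (tm0 tm1 : A -> nat).
Hypotheses (mT : marriage T X) (gE : good T E).
Hypotheses (s0 : St E N0) (s1 : St E N1).
Hypotheses (a0 : acyclic_over T X N0 tm0) (a1 : acyclic_over T (~: X) N1 tm1).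
Hypothesis mid : forall x y, x \in X -> y \in pref T x -> ~~ E x y ->
  rk y (N1 y) < rk y x -> rk y x < rk y (N0 y) -> ~ consistent T x y E.

(** Adding the edges of [m] keeps [m] and all old matchings stable. Acyclicity on both sides places
    any new edge strictly between the two extremes [N0] and [N1], and opposite interests make it
    consistent, which [mid] forbids. *)
Lemma compatible_stable m : involutive m -> (forall z, m z <> z -> m z \in pref T z) ->
  (forall N a, St E N -> m a <> a -> rk a (m a) < rk a (N a) ->
     rk (m a) a < rk (m a) (N (m a)) -> False) ->
  (forall N a, St E N -> N a <> a -> rk a (N a) < rk a (m a) ->
     rk (N a) a < rk (N a) (m (N a)) -> False) ->
  St E m.
Proof.
move=> im pm b1 b2.
have sE := good_sub gE; have yE := good_sym gE.
pose F u v := E u v || ((m u == v) && (m u != u)).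
have sF : subT T F by move=> u v /orP[/sE//|/andP[/eqP<- /eqP/pm]].
have mono N : St E N -> St F N.
  move=> sN; apply/StP; split; first exact: (St_invol sN).
    by move=> z hz; rewrite /F (St_edge sN hz).
  move=> a b /orP[/(St_nb sN)//|/andP[/eqP <- /eqP hne]]; exact: b1.
have nbm a b : E a b -> rk a b < rk a (m a) -> rk b a < rk b (m b) -> False.
  move=> hE; have [N sN eN] := good_st gE hE; rewrite -eN; apply: b2 => //.
  by rewrite eN; apply/pref_neq/sE.
have sm : St F m.
  apply/StP; split=> //; first by move=> z hz; rewrite /F eqxx (introN eqP hz) orbT.
  by move=> a b /orP[/nbm//|/andP[/eqP <- _]]; rewrite ltnn.
suff key x : x \in X -> m x <> x -> E x (m x).
  apply/StP; split=> // z hz; case zX : (z \in X); first exact: key.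
  rewrite yE -{2}[z]im; apply: key; last by rewrite im => /esym.
  by rewrite (side_pref mT (pm _ hz)) zX.
move=> hx hne; apply: contraT => nE.
have yp := pm _ hne.
have xp : x \in pref T (m x) by rewrite pref_sym.
have u0 : rk x (N0 x) < rk x (m x).
  have := acyclic_no_up mT sF (mono _ s0) a0 sm hx.
  case: (eqVneq (N0 x) x) => [e|/eqP n0].
    by rewrite e leqNgt rk_self yp.
  by apply: rk_lt_le; [apply/sE/(St_edge s0)|move=> e; move: nE; rewrite -e (St_edge s0)].
have u1 : rk (m x) (N1 (m x)) < rk (m x) x.
  have hy : m x \in ~: X by rewrite inE (side_pref mT yp) hx.
  have := acyclic_no_up (marriageC mT) sF (mono _ s1) a1 sm hy; rewrite im.
  case: (eqVneq (N1 (m x)) (m x)) => [e|/eqP n1].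
    by rewrite e leqNgt rk_self xp.
  apply: rk_lt_le; first exact/sE/(St_edge s1).
  by move=> e; move: nE; rewrite yE -{2}e (St_edge s1).
case: (mid hx yp nE u1); first exact: (St_opp2 sF (mono _ s0) sm u0).
move=> N sN; exact: (St_oppE _ sF sm (mono _ sN)).
Qed.

End Closure.

(** * Matchings as sets of edges *)

Section Encode.
Variable A : finType.
Implicit Types (T : instance A) (M : {set {set A}}) (m N : {ffun A -> A}).

Definition fun_of M : {ffun A -> A} := [ffun z => odflt z (partner M z)].

Definition set_of m : {set {set A}} := [set [set z; m z] | z in [set z | m z != z]].

Lemma set2_eq (a b z w : A) : [set a; b] = [set z; w] ->
  (a = z /\ b = w) \/ (a = w /\ b = z).
Proof.
move=> e.
have : a \in [set z; w] by rewrite -e !inE eqxx.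
have : b \in [set z; w] by rewrite -e !inE eqxx orbT.
have : z \in [set a; b] by rewrite e !inE eqxx.
have : w \in [set a; b] by rewrite e !inE eqxx orbT.
rewrite !inE => /orP[]/eqP ? /orP[]/eqP ? /orP[]/eqP ? /orP[]/eqP ?; subst; by [left|right].
Qed.

Lemma edges_pair T a b : ([set a; b] \in edges T) = (b \in pref T a).
Proof.
rewrite inE; apply/existsP/idP => [[z /existsP[w /andP[h /eqP e]]]|h].
  by case: (set2_eq e) => -[-> ->] //; rewrite pref_sym.
by exists a; apply/existsP; exists b; rewrite h eqxx.
Qed.

Lemma matching_disj T M e1 e2 z : is_matching T M ->
  e1 \in M -> e2 \in M -> z \in e1 -> z \in e2 -> e1 = e2.
Proof.
case/andP => _ /trivIsetP tM h1 h2 z1 z2; apply/eqP; apply: contraT => ne.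
by move/disjoint_setI0: (tM _ _ h1 h2 ne) => /setP /(_ z); rewrite !inE z1 z2.
Qed.

Lemma fun_of_pair T M a b : is_matching T M -> [set a; b] \in M -> fun_of M a = b.
Proof.
move=> hM hab; rewrite ffunE /partner.
have hb : b \in pref T a by rewrite -edges_pair; apply: (subsetP (proj1 (andP hM))).
case: pickP => /= [w /andP[hw h]|/(_ b)]; last by rewrite hab andbT; move/eqP: (pref_neq hb) => ->.
have := matching_disj hM hab h (z := a); rewrite !inE eqxx => /(_ isT isT).
by case/set2_eq => -[? ?]; subst => //; rewrite eqxx in hw.
Qed.

Lemma fun_of_edge M z : fun_of M z <> z -> [set z; fun_of M z] \in M.
Proof. by rewrite ffunE /partner; case: pickP => //= w /andP[]. Qed.

Lemma fun_of_pref T M z : is_matching T M -> fun_of M z <> z -> fun_of M z \in pref T z.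
Proof.
by move=> hM /fun_of_edge h; rewrite -edges_pair; apply: (subsetP (proj1 (andP hM))).
Qed.

Lemma fun_of_invol T M : is_matching T M -> involutive (fun_of M).
Proof.
move=> hM z; have [e|/eqP ne] := eqVneq (fun_of M z) z; first by rewrite !e.
by apply: (fun_of_pair hM); rewrite setUC; apply: fun_of_edge.
Qed.

Lemma prefersE T M a b : prefers T a b (partner M a) = (rk T a b < rk T a (fun_of M a)).
Proof.
rewrite /prefers ffunE; case: (partner M a) => [c|] /=; last by rewrite andbT rk_self.
by apply/andP/idP => [[]//|h]; split => //; apply: rk_ltW h.
Qed.

Lemma edge_blocksE T M a b : edge_blocks T a b M =
  (rk T a b < rk T a (fun_of M a)) && (rk T b a < rk T b (fun_of M b)).
Proof.
rewrite /edge_blocks !prefersE; apply/and3P/andP => [[]//|[h1 h2]].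
by split => //; apply: rk_ltW h1.
Qed.

Lemma set_of_matching T m : involutive m -> (forall z, m z <> z -> m z \in pref T z) ->
  is_matching T (set_of m).
Proof.
move=> im pm; apply/andP; split.
  apply/subsetP => e /imsetP[z]; rewrite inE => /eqP hz ->.
  by rewrite edges_pair; apply: pm.
apply/trivIsetP => _ _ /imsetP[z _ ->] /imsetP[w _ ->] ne.
rewrite -setI_eq0; apply: contraNT ne => /set0Pn[c].
rewrite !inE => /andP[/orP[]/eqP-> /orP[]/eqP e]; apply/eqP.
- by rewrite e.
- by rewrite e im setUC.
- by rewrite -e im setUC.
- by rewrite (can_inj im e).
Qed.

Lemma set_ofK T m : involutive m -> (forall z, m z <> z -> m z \in pref T z) ->
  fun_of (set_of m) = m.
Proof.
move=> im pm; have hM := set_of_matching im pm.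
apply/ffunP => z; have [e|/eqP ne] := eqVneq (m z) z; last first.
  by apply: (fun_of_pair hM); apply/imsetP; exists z => //; rewrite inE; apply/eqP.
rewrite e; apply/eqP; apply: contraT => /eqP h; exfalso.
have /imsetP[w] := fun_of_edge h; rewrite inE => /eqP hw /set2_eq[[e1 e2]|[e1 e2]].
  by apply: hw; rewrite -e1.
by apply: hw; rewrite -[RHS]im -e1 e.
Qed.

Lemma index_filter_lt (s : seq A) (p : pred A) b c : uniq s ->
  b \in filter p s -> c \in filter p s ->
  (index b (filter p s) < index c (filter p s)) = (index b s < index c s).
Proof.
elim: s => //= d s IH /andP[hd us]; case: ifP => pd /=.
  rewrite !inE; have [->|db] := eqVneq b d; have [->|dc] := eqVneq c d => //=.
  by rewrite !ltnS; apply: IH.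
move=> hb hc.
have hb' : b \in s by move: hb; rewrite mem_filter => /andP[].
have hc' : c \in s by move: hc; rewrite mem_filter => /andP[].
have [e|db] := eqVneq d b; first by rewrite e hb' in hd.
have [e|dc] := eqVneq d c; first by rewrite e hc' in hd.
by rewrite ltnS; apply: IH.
Qed.

Definition adj T : rel A := fun a b => b \in pref T a.

Lemma subtable_adj T' T : subtable T' T -> subT T (adj T').
Proof.
by case/andP => _ /forallP h a b; rewrite /adj (eqP (h a)) mem_filter => /andP[].
Qed.

Lemma subtable_rk T' T a b c : subtable T' T -> b \in pref T' a ->
  (c <> a -> c \in pref T' a) -> (rk T' a b < rk T' a c) = (rk T a b < rk T a c).
Proof.
move=> hs hb hc; have [e|/eqP ne] := eqVneq c a.
  by rewrite e !rk_self hb; apply/esym/(subtable_adj hs).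
have {}hc := hc ne; case/andP: hs => _ /forallP /(_ a) /eqP e.
rewrite /rk e index_filter_lt ?pref_uniq //; by rewrite -e.
Qed.

(** Restricting a list preserves comparisons of listed agents and keeps the owner's rank last, so
    the ranks of [T] can serve every subtable. *)
Lemma is_stableE T' T M : subtable T' T ->
  is_stable T' M = is_matching T M && St T (adj T') (fun_of M).
Proof.
move=> hs; have [hE _] := andP hs.
apply/andP/andP => -[hM hst].
  have hMT : is_matching T M.
    by case/andP: hM => h1 h2; apply/andP; split=> //; apply: subset_trans hE.
  split=> //; apply/StP; split; first exact: fun_of_invol hM.
    by move=> z; apply: fun_of_pref.
  move=> a b hab h1 h2; move/forallP: hst => /(_ a) /forallP /(_ b); rewrite edge_blocksE.
  have hba : a \in pref T' b by rewrite pref_sym.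
  by rewrite !(subtable_rk hs) ?h1 ?h2 //; apply: fun_of_pref.
have hM' : is_matching T' M.
  case/andP: (hM) => h1 h2; apply/andP; split=> //; apply/subsetP => e he.
  have := subsetP h1 _ he; rewrite inE => /existsP[z /existsP[w /andP[h /eqP ee]]].
  rewrite ee edges_pair; rewrite ee in he; have ew := fun_of_pair hM he.
  by rewrite -ew; apply: (St_edge hst); rewrite ew; apply: pref_neq h.
split=> //; apply/forallP => a; apply/forallP => b; rewrite edge_blocksE.
apply/negP => /andP[h1 h2].
have hab := rk_ltW h1; have hba := rk_ltW h2.
rewrite (subtable_rk hs) // in h1; last by apply: fun_of_pref.
rewrite (subtable_rk hs) // in h2; last by apply: fun_of_pref.
exact: (St_nb hst hab).
Qed.

Lemma adj_good T0 T : subtable T0 T -> stable_table T0 -> good T (adj T0).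
Proof.
move=> hs /forallP ht; have st a b : adj T0 a b -> exists2 m, St T (adj T0) m & m a = b.
  move=> hab; move: (ht [set a; b]); rewrite edges_pair -/(adj T0 a b) hab /= => /exists_inP[M].
  rewrite inE => hM hm; exists (fun_of M).
    by move: hM; rewrite (is_stableE _ hs) => /andP[].
  by apply: (@fun_of_pair T0) => //; case/andP: hM.
split=> //.
- by move=> a b; rewrite /adj pref_sym.
- exact: subtable_adj.
case: (boolP [exists a, exists b, adj T0 a b]) => [/existsP[a /existsP[b /st[m]]]|].
  by exists m.
(* Without edges [st] supplies no matching; the identity, that is the empty matching, is stable. *)
rewrite negb_exists => /forallP h; exists [ffun z => z]; apply/StP; split.
- by move=> z; rewrite !ffunE.
- by move=> z; rewrite ffunE.
- by move=> a b hab; move: (h a); rewrite negb_exists => /forallP /(_ b); rewrite hab.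
Qed.

Section Table.
Variables (T : instance A) (E : rel A).
Hypotheses (sE : subT T E) (yE : symmetric E).

Definition table_pref z := [seq w <- pref T z | E z w].

Lemma mem_table_pref z w : (w \in table_pref z) = E z w.
Proof. by rewrite mem_filter; case h : (E z w) => //=; rewrite (sE h). Qed.

Lemma table_uniq z : uniq (table_pref z).
Proof. by rewrite filter_uniq // pref_uniq. Qed.

Lemma table_irr z : z \notin table_pref z.
Proof. by rewrite mem_filter negb_and pref_irr orbT. Qed.

Lemma table_sym z w : (w \in table_pref z) = (z \in table_pref w).
Proof. by rewrite !mem_table_pref yE. Qed.

Definition table : instance A := Instance table_uniq table_irr table_sym.

Lemma table_subtable : subtable table T.
Proof.
apply/andP; split.
  apply/subsetP => e; rewrite inE => /existsP[z /existsP[w /andP[h /eqP ->]]].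
  by rewrite edges_pair; apply: sE; rewrite -mem_table_pref.
by apply/forallP => z; apply/eqP; apply: eq_filter => w /=; rewrite mem_table_pref.
Qed.

Lemma St_eq (F : rel A) m : E =2 F -> St T E m = St T F m.
Proof.
move=> e; apply/StP/StP => -[h1 h2 h3]; split=> //.
- by move=> z hz; rewrite -e; apply: h2.
- by move=> a b; rewrite -e; apply: h3.
- by move=> z hz; rewrite e; apply: h2.
- by move=> a b; rewrite e; apply: h3.
Qed.

Lemma table_stableE M : is_stable table M = is_matching T M && St T E (fun_of M).
Proof.
rewrite (is_stableE _ table_subtable); congr andb.
by apply/esym/St_eq => a b; rewrite /adj mem_table_pref.
Qed.

End Table.

(** Maximality is tested one matching at a time: in an internally stable family containing the
    stable matchings of [E], a member neither blocks nor is blocked by any of them. *)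
Lemma table_closure T T0 E (sE : subT T E) (yE : symmetric E) :
  subtable T0 T ->
  (forall m, St T (adj T0) m -> St T E m) ->
  (forall m, involutive m -> (forall z, m z <> z -> m z \in pref T z) ->
    (forall N a, St T E N -> m a <> a -> rk T a (m a) < rk T a (N a) ->
       rk T (m a) a < rk T (m a) (N (m a)) -> False) ->
    (forall N a, St T E N -> N a <> a -> rk T a (N a) < rk T a (m a) ->
       rk T (N a) a < rk T (N a) (m (N a)) -> False) ->
    St T E m) ->
  internal_closure T (stable_matchings T0) (stable_matchings (table sE yE)).
Proof.
move=> hs h0 hcl; apply/andP; split; last first.
  apply/subsetP => M; rewrite !inE (is_stableE _ hs) table_stableE => /andP[-> /h0 ->] //.
apply/maxsetP; split.
  apply/andP; split.
    by apply/subsetP => M; rewrite !inE table_stableE => /andP[].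
  apply/forall_inP => M; rewrite inE table_stableE => /andP[hM hst].
  apply/forall_inP => M'; rewrite inE table_stableE => /andP[hM' hst'].
  apply/negP => /existsP[a /existsP[b /andP[hab]]]; rewrite edge_blocksE => /andP[].
  have e := fun_of_pair hM' hab; apply: (St_nb hst); rewrite -e.
  apply: (St_edge hst'); rewrite e; apply: (@pref_neq _ T).
  by rewrite -edges_pair; apply: (subsetP (proj1 (andP hM'))).
move=> F /andP[hF /forall_inP hblk] sub; apply/eqP; rewrite eqEsubset sub andbT.
apply/subsetP => M MF; rewrite inE table_stableE.
have hM : is_matching T M by have := subsetP hF _ MF; rewrite inE.
rewrite hM /=; apply: hcl.
- exact: fun_of_invol hM.
- by move=> z; apply: fun_of_pref.
- move=> N a sN hne l1 l2.
  have pN z : N z <> z -> N z \in pref T z by move=> /(St_edge sN) /sE.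
  have eN := set_ofK (St_invol sN) pN.
  have NF : set_of N \in F.
    apply: (subsetP sub); rewrite inE table_stableE eN sN andbT.
    exact: set_of_matching (St_invol sN) pN.
  move/forall_inP: (hblk _ NF) => /(_ _ MF) /negP; case.
  apply/existsP; exists a; apply/existsP; exists (fun_of M a).
  by rewrite fun_of_edge // edge_blocksE eN l1 l2.
- move=> N a sN hne l1 l2.
  have pN z : N z <> z -> N z \in pref T z by move=> /(St_edge sN) /sE.
  have eN := set_ofK (St_invol sN) pN.
  have NF : set_of N \in F.
    apply: (subsetP sub); rewrite inE table_stableE eN sN andbT.
    exact: set_of_matching (St_invol sN) pN.
  move/forall_inP: (hblk _ MF) => /(_ _ NF) /negP; case.
  apply/existsP; exists a; apply/existsP; exists (N a).
  by rewrite edge_blocksE l1 l2 -{1}eN fun_of_edge // eN.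
Qed.

End Encode.

(** * Loop programs *)

(* All loops run over [0 <= r < n], with [n] in register 0; [PInc] saturates at [n],
   which keeps every cell below [n.+2] without semantic side conditions. *)
Inductive prog :=
| PSet of nat & expr
| PPut of nat & expr & expr
| PInc of nat
| PSeq of prog & prog
| PIf of expr & prog
| PFor of nat & prog.

Fixpoint compile (p : prog) : cmd :=
  match p with
  | PSet r e => SetReg r e
  | PPut a i e => Put a i e
  | PInc r => SetReg r (Bin Add (Reg r) (Bin Ltn (Reg r) (Reg 0)))
  | PSeq p q => Seq (compile p) (compile q)
  | PIf e p => If e (compile p) Skip
  | PFor r p => Seq (SetReg r (Cst 0))
      (While (Bin Ltn (Reg r) (Reg 0))
         (Seq (compile p) (SetReg r (Bin Add (Reg r) (Cst 1)))))
  end.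

Fixpoint ev (s : state) (e : expr) : nat :=
  match e with
  | Cst k => k
  | Reg x => reg s x
  | Get a e1 => arr s a (ev s e1)
  | Bin o e1 e2 => binop_val o (ev s e1) (ev s e2)
  end.

(* In a state with all cells below [n.+2], the value of [e] is below
   [n.+2 ^ deg e]. *)
Fixpoint deg (e : expr) : nat :=
  match e with
  | Bin Add e1 e2 => (maxn (deg e1) (deg e2)).+1
  | Bin Mul e1 e2 => deg e1 + deg e2
  | Bin Defs.Sub e1 _ => deg e1
  | _ => 1
  end.

(** Constants 0 and 1 are below [n.+2] for every [n]; degree 9 is the word size fixed below. *)
Fixpoint okx (e : expr) : bool :=
  match e with
  | Cst k => k <= 1
  | Reg _ => true
  | Get _ e1 => okx e1
  | Bin o e1 e2 => [&& okx e1, okx e2 & deg e <= 9]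
  end.

Fixpoint wr (p : prog) : seq nat :=
  match p with
  | PSet r _ | PInc r => [:: r]
  | PPut _ _ _ => [::]
  | PSeq p q => wr p ++ wr q
  | PIf _ p => wr p
  | PFor r p => r :: wr p
  end.

Fixpoint wa (p : prog) : seq nat :=
  match p with
  | PSet _ _ | PInc _ => [::]
  | PPut a _ _ => [:: a]
  | PSeq p q => wa p ++ wa q
  | PIf _ p => wa p
  | PFor _ p => wa p
  end.

Fixpoint okp (p : prog) : bool :=
  match p with
  | PSet r e => [&& r != 0, okx e & deg e <= 1]
  | PPut _ i e => [&& okx i, okx e & deg e <= 1]
  | PInc r => r != 0
  | PSeq p q => okp p && okp q
  | PIf e p => okx e && okp p
  | PFor r p => [&& r != 0, r \notin wr p & okp p]
  end.

Fixpoint depth (p : prog) : nat :=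
  match p with
  | PSet _ _ | PPut _ _ _ | PInc _ => 0
  | PSeq p q => maxn (depth p) (depth q)
  | PIf _ p => depth p
  | PFor _ p => (depth p).+1
  end.

(** * Semantics, running time and word size of loop programs *)

Section Run.
Variable n : nat.

Fixpoint run (p : prog) (s : state) : state :=
  match p with
  | PSet r e => set_reg s r (ev s e)
  | PPut a i e => set_arr s a (ev s i) (ev s e)
  | PInc r => set_reg s r (reg s r + (reg s r < n))
  | PSeq p q => run q (run p s)
  | PIf e p => if ev s e != 0 then run p s else s
  | PFor r p =>
      iter n (fun s => set_reg (run p s) r (reg (run p s) r).+1) (set_reg s r 0)
  end.

(** One pass of a loop adds 9: test 3, increment 4, and one unit each for [Seq] and [While]. The 7
    are initialisation 2, [Seq] 1 and the failing last test 4. *)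
Fixpoint cost (p : prog) : nat :=
  match p with
  | PSet _ e => (expr_cost e).+1
  | PPut _ i e => (expr_cost i + expr_cost e).+1
  | PInc _ => 6
  | PSeq p q => (cost p + cost q).+1
  | PIf e p => expr_cost e + cost p + 2
  | PFor _ p => n * (cost p + 9) + 7
  end.

Lemma run_reg p s r : r \notin wr p -> reg (run p s) r = reg s r.
Proof.
elim: p s => /=.
- by move=> r' e s; rewrite inE /update => /negbTE ->.
- by [].
- by move=> r' s; rewrite inE /update => /negbTE ->.
- by move=> p IHp q IHq s; rewrite mem_cat negb_or => /andP[h1 h2]; rewrite IHq ?IHp.
- by move=> e p IH s h; case: ifP => // _; apply: IH.
- move=> r' p IH s; rewrite inE negb_or => /andP[h1 h2].
  elim: n => [|k IHk] /=; first by rewrite /update (negbTE h1).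
  by rewrite {1}/update (negbTE h1) IH.
Qed.

Lemma run_arr p s a : a \notin wa p -> arr (run p s) a = arr s a.
Proof.
elim: p s => //=.
- by move=> a' i e s; rewrite inE /update => /negbTE ->.
- by move=> p IHp q IHq s; rewrite mem_cat negb_or => /andP[h1 h2]; rewrite IHq ?IHp.
- by move=> e p IH s h; case: ifP => // _; apply: IH.
- by move=> r p IH s h; elim: n => [|k IHk] //=; rewrite IH.
Qed.

(** The step receives the frame conditions for untouched registers and arrays, so invariants need
    only mention what the body changes; they must not depend on the counter, which the loop itself
    writes. *)
Lemma run_for r p (I : nat -> state -> Prop) s : r \notin wr p ->
  (forall k s' v, I k s' -> I k (set_reg s' r v)) ->
  I 0 s ->
  (forall k s', k < n -> reg s' r = k ->
     (forall q, q \notin r :: wr p -> reg s' q = reg s q) ->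
     (forall a, a \notin wa p -> arr s' a = arr s a) ->
     I k s' -> I k.+1 (run p s')) ->
  I n (run (PFor r p) s).
Proof.
move=> hr hI h0 hstep /=.
suff H k : k <= n ->
  let s' := iter k (fun s => set_reg (run p s) r (reg (run p s) r).+1) (set_reg s r 0) in
  [/\ I k s', reg s' r = k, forall q, q \notin r :: wr p -> reg s' q = reg s q &
      forall a, a \notin wa p -> arr s' a = arr s a] by case: (H n (leqnn n)).
elim: k => [|k IH] hk /=.
  split=> //; [exact: hI|by rewrite /update eqxx|].
  by move=> q; rewrite inE negb_or /update => /andP[/negbTE -> _].
have [h1 h2 h3 h4] := IH (ltnW hk); set s' := iter k _ _ in h1 h2 h3 h4 *.
split.
- by apply/hI/hstep.
- by rewrite /update eqxx run_reg // h2.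
- move=> q hq; rewrite -h3 // /update; move: hq; rewrite inE negb_or => /andP[/negbTE-> h].
  by rewrite run_reg.
- by move=> a ha; rewrite run_arr // h4.
Qed.

Lemma run_for2 r1 r2 p (I : nat -> nat -> state -> Prop) s :
  r1 \notin r2 :: wr p -> r2 \notin wr p ->
  (forall j k s' v, I j k s' -> I j k (set_reg s' r1 v)) ->
  (forall j k s' v, I j k s' -> I j k (set_reg s' r2 v)) ->
  I 0 0 s ->
  (forall j k s', j < n -> k < n -> reg s' r1 = j -> reg s' r2 = k ->
     (forall q, q \notin [:: r1, r2 & wr p] -> reg s' q = reg s q) ->
     (forall a, a \notin wa p -> arr s' a = arr s a) ->
     I j k s' -> I j k.+1 (run p s')) ->
  (forall j s', j < n -> I j n s' -> I j.+1 0 s') ->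
  I n 0 (run (PFor r1 (PFor r2 p)) s).
Proof.
move=> h1 h2 i1 i2 h0 hstep hrow.
apply: (@run_for r1 (PFor r2 p) (fun j => I j 0)) => //.
  by move=> *; apply: i1.
move=> j s' hj e1 f1 f2 hI; apply: hrow => //.
apply: (@run_for r2 p (I j) s') => //; first by move=> *; apply: i2.
move=> k s'' hk e2 g1 g2 hI'; apply: hstep => //.
- by rewrite g1.
- move=> q hq; rewrite g1 ?f1 //; move: hq.
  by rewrite !inE !negb_or => /and3P[_ -> ->].
- by move=> a ha; rewrite g2 // f2.
Qed.

Definition bounded (s : state) :=
  (forall r, reg s r < n.+2) /\ (forall a i, arr s a i < n.+2).

(** A generous exponent: the expressions of the algorithm have degree at most 4, attained by
    [candx]. *)
Let W := n.+2 ^ 9.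

Lemma ev_ok s e : bounded s -> okx e ->
  ev s e < n.+2 ^ deg e /\ eval W s e = ev s e.
Proof.
move=> [b1 b2]; elim: e => [k|r|a e IH|o e1 IH1 e2 IH2] /=.
- move=> hk; rewrite expn1; split; first by apply: leq_trans (_ : 2 <= _); rewrite ?ltnS.
  have hW : n.+2 ^ 1 <= W by rewrite leq_pexp2l.
  by rewrite expn1 in hW; rewrite modn_small //; lia.
- by rewrite expn1.
- by case/IH => _ ->; rewrite expn1.
case/and3P => /IH1[h1 ->] /IH2[h2 ->] hd.
set v := binop_val _ _ _.
suff hv : v < n.+2 ^ deg (Bin o e1 e2).
  by split=> //; rewrite modn_small // (leq_trans hv) // /W leq_pexp2l.
rewrite /v; case: o {hd v} => /=.
(* A sum at most doubles the larger bound, and the base is at least 2. *)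
- have m1 : n.+2 ^ deg e1 <= n.+2 ^ maxn (deg e1) (deg e2) by rewrite leq_pexp2l ?leq_maxl.
  have m2 : n.+2 ^ deg e2 <= n.+2 ^ maxn (deg e1) (deg e2) by rewrite leq_pexp2l ?leq_maxr.
  rewrite expnS; nia.
- by apply: leq_ltn_trans h1; rewrite leq_subr.
- by rewrite expnD ltn_mul.
- by rewrite expn1; case: (ev s e1 < _).
- by rewrite expn1; case: (ev s e1 == _).
Qed.

Lemma bounded_set_reg s r v : bounded s -> v < n.+2 -> bounded (set_reg s r v).
Proof. by case=> h1 h2 hv; split=> // q /=; rewrite /update; case: ifP. Qed.

Lemma bounded_set_arr s a i v : bounded s -> v < n.+2 -> bounded (set_arr s a i v).
Proof.
case=> h1 h2 hv; split=> // b j /=; rewrite /update; case: ifP => // _.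
by case: ifP.
Qed.

Lemma small_ev s e : bounded s -> okx e -> deg e <= 1 -> ev s e < n.+2.
Proof.
move=> hb ho hd; have [h _] := ev_ok hb ho.
by apply: (leq_trans h); rewrite -[X in _ <= X]expn1 leq_pexp2l.
Qed.

Lemma okp_reg0 p : okp p -> 0 \notin wr p.
Proof.
elim: p => //=.
- by move=> r e /and3P[h _ _]; rewrite inE eq_sym.
- by move=> r h; rewrite inE eq_sym.
- by move=> p IHp q IHq /andP[/IHp h1 /IHq h2]; rewrite mem_cat negb_or h1.
- by move=> e p IH /andP[_ /IH].
- by move=> r p IH /and3P[h _ /IH h2]; rewrite inE negb_or eq_sym h.
Qed.

Lemma run_exec p s : okp p -> bounded s -> reg s 0 = n ->
  (exists2 t, exec W (compile p) s t (run p s) & t <= cost p) /\ bounded (run p s).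
Proof.
elim: p s => /=.
- move=> r e s /and3P[_ ho hd] hb _; have [_ e1] := ev_ok hb ho.
  split; last by apply: bounded_set_reg => //; apply: small_ev.
  by exists (expr_cost e).+1 => //; rewrite -e1; constructor.
- move=> a i e s /and3P[hi ho hd] hb _; have [_ e1] := ev_ok hb ho; have [_ e2] := ev_ok hb hi.
  split; last by apply: bounded_set_arr => //; apply: small_ev.
  by exists (expr_cost i + expr_cost e).+1 => //; rewrite -e1 -e2; constructor.
- move=> r s _ hb h0; have hr := hb.1 r.
  split; last by apply: bounded_set_reg => //; case: ltnP => h; lia.
  exists 6 => //.
  pose e := Bin Add (Reg r) (Bin Ltn (Reg r) (Reg 0)).
  have [_ e1] := @ev_ok s e hb isT.
  have -> : reg s r + (reg s r < n) = eval W s e by rewrite e1 /= h0.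
  exact: (ExecSetReg W s r e).
- move=> p IHp q IHq s /andP[op oq] hb h0.
  have [[t1 x1 l1] b1] := IHp s op hb h0.
  have h0' : reg (run p s) 0 = n by rewrite run_reg ?okp_reg0.
  have [[t2 x2 l2] b2] := IHq _ oq b1 h0'.
  split=> //; exists (t1 + t2).+1; first exact: ExecSeq x1 x2.
  by rewrite ltnS leq_add.
- move=> e p IH s /andP[oe op] hb h0; have [_ e1] := ev_ok hb oe.
  case: ifP => he.
    have [[t x l] b] := IH s op hb h0; split=> //.
    exists (expr_cost e + t).+1; first by apply: ExecIfTrue => //; rewrite e1 he.
    lia.
  split=> //; exists (expr_cost e + 1).+1; last by lia.
  by apply: ExecIfFalse; [rewrite e1; apply/eqP; apply: negbFE|constructor].
- move=> r p IH s /and3P[r0 rp op] hb h0.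
  pose step s := set_reg (run p s) r (reg (run p s) r).+1.
  pose body := While (Bin Ltn (Reg r) (Reg 0))
    (Seq (compile p) (SetReg r (Bin Add (Reg r) (Cst 1)))).
  rewrite -/body -/step.
  have loop j k s' : k + j = n -> reg s' r = k -> reg s' 0 = n -> bounded s' ->
    (exists2 t, exec W body s' t (iter j step s') & t <= j * (cost p + 9) + 4) /\
    bounded (iter j step s').
    elim: j k s' => [|j IHj] k s' hk hr hn bs.
      split=> //; exists 4 => //; apply: ExecWhileFalse.
      have [_ ->] := @ev_ok s' (Bin Ltn (Reg r) (Reg 0)) bs isT.
      by rewrite /= hr hn; case: ltnP => //; lia.
    rewrite iterSr.
    have [[t1 x1 l1] b1] := IH s' op bs hn.
    have hr1 : reg (run p s') r = k by rewrite run_reg.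
    have hn1 : reg (run p s') 0 = n by rewrite run_reg ?okp_reg0.
    have bst : bounded (step s') by apply: bounded_set_reg => //; rewrite hr1; lia.
    have [||||[t2 x2 l2] b2] // := IHj k.+1 (step s').
    - by rewrite addSn -hk addnS.
    - by rewrite /step /= /update eqxx hr1.
    - by rewrite /step /= /update eq_sym (negbTE r0).
    split=> //; exists (expr_cost (Bin Ltn (Reg r) (Reg 0)) + (t1 + 4).+1 + t2).+1; last first.
      by rewrite /=; lia.
    apply: ExecWhileTrue x2.
      have [_ ->] := @ev_ok s' (Bin Ltn (Reg r) (Reg 0)) bs isT.
      by rewrite /= hr hn; case: ltnP => //; lia.
    apply: ExecSeq x1 _.
    have [_ e1] := @ev_ok (run p s') (Bin Add (Reg r) (Cst 1)) b1 isT.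
    have -> : step s' = set_reg (run p s') r (eval W (run p s') (Bin Add (Reg r) (Cst 1))).
      by rewrite e1 /= addn1.
    exact: ExecSetReg.
  have b0 : bounded (set_reg s r 0) by apply: bounded_set_reg.
  have [|||| [t x l] b] // := loop n 0 (set_reg s r 0).
  + by rewrite /= /update eqxx.
  + by rewrite /= /update eq_sym (negbTE r0).
  split=> //; exists (2 + t).+1; last by lia.
  apply: ExecSeq x.
  have -> : set_reg s r 0 = set_reg s r (eval W s (Cst 0)) by rewrite /= mod0n.
  exact: ExecSetReg.
Qed.

End Run.

Lemma cost_bound p : exists c, forall n, 0 < n -> cost n p <= c * n ^ depth p.
Proof.
have e0 n k : 0 < n -> 0 < n ^ k by move=> n0; rewrite expn_gt0 n0.
have mono n k l : 0 < n -> k <= l -> n ^ k <= n ^ l by move=> n0 h; rewrite leq_pexp2l.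
elim: p => /=.
- by move=> _ e; exists (expr_cost e).+1 => n _; rewrite expn0 muln1.
- by move=> _ i e; exists (expr_cost i + expr_cost e).+1 => n _; rewrite expn0 muln1.
- by move=> _; exists 6 => n _; rewrite expn0.
- move=> p [c hc] q [d hd]; exists (c + d).+1 => n n0.
  have h1 := leq_trans (hc n n0) (leq_mul (leqnn c) (mono n _ _ n0 (leq_maxl (depth p) (depth q)))).
  have h2 := leq_trans (hd n n0) (leq_mul (leqnn d) (mono n _ _ n0 (leq_maxr (depth p) (depth q)))).
  have := e0 n (maxn (depth p) (depth q)) n0; nia.
- move=> e p [c hc]; exists (expr_cost e + c + 2) => n n0.
  by have := e0 n (depth p) n0; have := hc n n0; nia.
- move=> _ p [c hc]; exists (c + 16) => n n0; rewrite expnS.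
  have h1 := e0 n (depth p) n0; have h2 := hc n n0.
  have h3 : n * cost n p <= n * (c * n ^ depth p) by rewrite leq_mul2l h2 orbT.
  have h4 : n <= n * n ^ depth p by rewrite -{1}[n]muln1 leq_mul2l h1 orbT.
  by nia.
Qed.

(** * The algorithm *)

(* Array 7 holds the ranks, array 8 the adjacency matrix of the current table; in a
   trading phase array 9 holds the optimal matching, 10 the agents still trading,
   11 their favourites and 12 the agents on trading cycles. *)
Notation "p ;; q" := (PSeq p q) (at level 61, right associativity).

Definition ltx := Bin Ltn.
Definition eqx := Bin Eqn.
Definition andx := Bin Mul.
Definition orx := Bin Add.
Definition ix (e f : expr) := Bin Add (Bin Mul e (Reg 0)) f.
Definition at2 (a : nat) (e f : expr) := Get a (ix e f).

Definition improve (dst a w : nat) (c : expr) : prog :=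
  PIf c (PIf (ltx (at2 7 (Reg a) (Reg w)) (at2 7 (Reg a) (Reg dst)))
    (PSet dst (Reg w))).

(* The default [dst := a] is the worst entry of row [a], so no sentinel is needed. *)
Definition search (dst a w : nat) (c : expr) : prog :=
  PSet dst (Reg a) ;; PFor w (improve dst a w c).

Definition ttc_top (b : bool) : prog :=
  PFor 1 (PPut 9 (Reg 1) (Reg 1)) ;;
  PFor 1 (PIf (eqx (Get 0 (Reg 1)) (Cst b))
    (search 2 1 3 (at2 8 (Reg 1) (Reg 3)) ;;
     PPut 9 (Reg 1) (Reg 2) ;; PPut 9 (Reg 2) (Reg 1))).

Definition matched_side (b : bool) : expr :=
  ltx (eqx (Get 9 (Reg 1)) (Reg 1)) (eqx (Get 0 (Reg 1)) (Cst b)).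

Definition ttc_alive (b : bool) : prog := PFor 1 (PPut 10 (Reg 1) (matched_side b)).

Definition candx : expr :=
  andx (Get 10 (Get 9 (Reg 3)))
    (orx (eqx (Reg 3) (Get 9 (Reg 1)))
       (andx (ltx (at2 7 (Reg 1) (Reg 3)) (at2 7 (Reg 1) (Get 9 (Reg 1))))
             (ltx (at2 7 (Reg 3) (Get 9 (Reg 3))) (at2 7 (Reg 3) (Reg 1))))).

Definition ttc_fav : prog :=
  PFor 1 (PIf (Get 10 (Reg 1)) (search 2 1 3 candx ;; PPut 11 (Reg 1) (Reg 2))).

Definition ttc_mark : prog :=
  PFor 1 (PPut 12 (Reg 1) (Cst 0)) ;;
  PFor 1 (PIf (Get 10 (Reg 1))
    (PSet 2 (Reg 1) ;; PFor 3 (PSet 2 (Get 9 (Get 11 (Reg 2)))) ;;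
     PPut 12 (Reg 2) (Cst 1))).

Definition ttc_kill : prog := PFor 1 (PIf (Get 12 (Reg 1)) (PPut 10 (Reg 1) (Cst 0))).

Definition ttc_add (b : bool) : prog :=
  PFor 1 (PIf (matched_side b)
    (PSet 2 (Get 11 (Reg 1)) ;; PPut 8 (ix (Reg 1) (Reg 2)) (Cst 1) ;;
     PPut 8 (ix (Reg 2) (Reg 1)) (Cst 1))).

Definition ttc (b : bool) : prog :=
  ttc_top b ;; ttc_alive b ;; PFor 4 (ttc_fav ;; ttc_mark ;; ttc_kill) ;; ttc_add b.

(** * Correctness of the trading phase *)

Section Verify.
Variables (n : nat) (T : instance 'I_n) (X : {set 'I_n}).
Implicit Types (s : state) (E : rel 'I_n) (x y z u v : 'I_n).
Local Notation run := (run n).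

Definition mat s a (f : 'I_n -> 'I_n -> nat) := forall x y, arr s a (x * n + y) = f x y.
Definition vec s a (f : 'I_n -> nat) := forall x, arr s a x = f x.

Lemma cell_eq x y x' y' : (x * n + y == x' * n + y') = (x == x') && (y == y').
Proof.
apply/eqP/andP => [e|[/eqP-> /eqP->] //].
have h (z w : 'I_n) : (z * n + w) %/ n = z + 0 :> nat /\ (z * n + w) %% n = w :> nat.
  have n0 : 0 < n by apply: leq_ltn_trans (ltn_ord z).
  by rewrite modnMDl modn_small // divnMDl // divn_small.
have [h1 h2] := h x y; have [h3 h4] := h x' y'.
rewrite !addn0 in h1 h3.
by split; apply/eqP/val_inj; [rewrite /= -h1 e h3|rewrite /= -h2 e h4].
Qed.

Record base s : Prop := Base {
  base_n : reg s 0 = n;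
  base_side : vec s 0 (fun z => z \in X);
  base_len : vec s 1 (fun z => size (pref T z));
  base_pref : forall z j, j < size (pref T z) ->
    arr s 2 (z * n + j) = nth 0 (map val (pref T z)) j;
  base_rk : mat s 7 (rk T) }.

Lemma base_frame s s' : base s -> reg s' 0 = reg s 0 ->
  arr s' 0 = arr s 0 -> arr s' 1 = arr s 1 -> arr s' 2 = arr s 2 -> arr s' 7 = arr s 7 -> base s'.
Proof.
case=> h1 h2 h3 h4 h5 e0 a0 a1 a2 a7; split; first by rewrite e0.
- by move=> z; rewrite a0.
- by move=> z; rewrite a1.
- by move=> z; rewrite a2; apply: h4.
- by move=> x y; rewrite a7.
Qed.

Lemma base_run p s : base s -> 0 \notin wr p -> ~~ has (mem (wa p)) [:: 0; 1; 2; 7] ->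
  base (run p s).
Proof.
move=> hb h0 /= /norP[a0 /norP[a1 /norP[a2 /norP[a7 _]]]].
by apply: (base_frame hb); rewrite ?run_reg ?run_arr.
Qed.

Lemma search_spec dst a w c s z (P : pred 'I_n) : uniq [:: 0; a; dst; w] ->
  base s -> reg s a = z -> (forall u, P u -> u \in pref T z) ->
  (forall s' u, (forall q, q != dst -> q != w -> reg s' q = reg s q) ->
     (forall b, arr s' b = arr s b) -> reg s' w = u -> (ev s' c != 0) = P u) ->
  reg (run (search dst a w c) s) dst = sel T z P.
Proof.
move=> hu hb ea hP hc; rewrite /= !inE !negb_or in hu.
case/and4P: hu => /and3P[a0 d0 w0] /andP[da aw] dw _.
suff [d [-> h1 h2]] : exists d : 'I_n, [/\ reg (run (search dst a w c) s) dst = d,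
    d = z \/ P d & forall u, u < n -> P u -> rk T z d <= rk T z u].
  by rewrite -(sel_uniq (d := d) hP) // => u; apply: h2.
rewrite -[run _ s]/(run (PFor w (improve dst a w c)) (set_reg s dst (reg s a))).
pose I k s' := exists d : 'I_n, [/\ reg s' dst = d,
    d = z \/ P d & forall u, u < k -> P u -> rk T z d <= rk T z u].
apply: (@run_for n w _ I).
- by rewrite /= inE eq_sym.
- move=> k s' v [d [h1 h2 h3]]; exists d; split=> //=.
  by rewrite /update (negbTE dw).
- exists z; split=> //; last by left.
  by rewrite /= /update eqxx ea.
move=> k s' hk ew fr fa [d [h1 h2 h3]].
have fr' q : q != dst -> q != w -> reg s' q = reg s q.
  move=> q1 q2; rewrite fr; first by rewrite /= /update (negbTE q1).
  by rewrite !inE negb_or q1 q2.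
pose u := Ordinal hk.
have := hc s' u fr' (fun b => fa b isT) ew.
rewrite [run _ s']/=; case: ifP => [he /esym Pu|he /esym nPu]; last first.
  exists d; split=> // v; rewrite ltnS leq_eqVlt => /orP[/eqP e|]; last exact: h3.
  by have -> : v = u; [apply: val_inj|rewrite nPu].
have sa : reg s' a = z by rewrite fr' // eq_sym.
have sn : reg s' 0 = n by rewrite fr' ?(base_n hb).
rewrite sa sn ew h1 !(fa 7 isT) /= -[k]/(val u) !(base_rk hb).
case: ltnP => /= hl.
  exists u; split; [by rewrite /= /update eqxx|by right|].
  move=> v; rewrite ltnS leq_eqVlt => /orP[/eqP e|/h3 h Pv].
    by have -> : v = u by apply: val_inj.
  by apply: leq_trans (ltnW hl) (h Pv).
exists d; split=> // v; rewrite ltnS leq_eqVlt => /orP[/eqP e|]; last exact: h3.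
by have -> : v = u by apply: val_inj.
Qed.

End Verify.

Lemma ltS_or (i k : nat) : (i < k.+1) = (i == k) || (i < k).
Proof. by rewrite ltnS leq_eqVlt. Qed.

Section VerifyTrading.
Variables (n : nat) (T : instance 'I_n) (X : {set 'I_n}).
Implicit Types (s : state) (E : rel 'I_n) (x y z u v : 'I_n).
Local Notation run := (run n).
Local Notation base := (base T X).

Variables (b : bool) (S : {set 'I_n}) (E : rel 'I_n).
Hypothesis mT : marriage T S.
Hypothesis hS : forall z, (z \in S) = ((z \in X) == b).
Hypothesis gE : good T E.
Let sE := good_sub gE.
Variable N0 : {ffun 'I_n -> 'I_n}.
Hypothesis s0 : St T E N0.
Hypothesis top0 : forall m, St T E m -> forall z, z \in S -> rk T z (N0 z) <= rk T z (m z).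
Let i0 := St_invol s0.

(** Every edge of a good table lies in a stable matching, so the optimal partner is the first
    neighbour and a linear search finds it. *)
Lemma top_sel x : x \in S -> N0 x = sel T x (E x).
Proof.
move=> hx; apply/esym/sel_uniq; first by move=> w /sE.
  by case: (eqVneq (N0 x) x) => [|/eqP h]; [left|right; apply: (St_edge s0)].
by move=> w hw; have [m sm <-] := good_st gE hw; apply: top0.
Qed.

Lemma side_test s x : base s -> reg s 1 = x ->
  ev s (eqx (Get 0 (Reg 1)) (Cst b)) = (x \in S).
Proof. by move=> hb e1; rewrite /= e1 (base_side hb) hS; case: (x \in X); case: b. Qed.

Lemma ttc_topP s : base s -> mat s 8 (fun x y => E x y) ->
  vec (run (ttc_top b) s) 9 (fun z => N0 z).
Proof.
move=> hb hE; rewrite /ttc_top.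
set p1 := PFor 1 (PPut 9 (Reg 1) (Reg 1)).
have h1 : vec (run p1 s) 9 (fun z => z).
  pose I (k : nat) s' := forall z, z < k -> arr s' 9 z = z.
  have : I n (run p1 s).
    apply: run_for => //= k s' hk e1 _ _ IH z; rewrite ltS_or /= e1 /update /=.
    by case: eqP => //= _; apply: IH.
  by move=> h z; apply: h.
set s1 := run p1 s in h1.
have hb1 : base s1 by apply: base_run.
have hE1 : mat s1 8 (fun x y => E x y) by rewrite /mat /s1 run_arr.
set p2 := PFor 1 (PIf _ _); rewrite -[run _ s]/(run p2 s1).
(* Cell [z] is written when the loop reaches the [S] end of its pair; for an unmatched [z] the
   initial value is already final. *)
pose key z := if z \in S then z else N0 z.
pose I (k : nat) s' := forall z, arr s' 9 z = if key z < k then N0 z else z.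
suff : I n (run p2 s1).
  by move=> h z; rewrite h ltn_ord.
apply: run_for => //.
move=> k s' hk e1 fr fa IH; pose x := Ordinal hk.
have hb' : base s' by apply: (base_frame hb1); rewrite ?fr ?fa.
have hE' : mat s' 8 (fun x y => E x y) by rewrite /mat fa.
set q := (search 2 1 3 _ ;; _).
rewrite [run _ s'](_ : _ = if x \in S then run q s' else s'); last first.
  by rewrite -(lt0b (x \in S)) -(side_test hb' (x := x) e1) lt0n.
case: ifP => hx; last first.
  move=> z; rewrite IH /key ltS_or.
  case hz : (z \in S).
    case: eqP => //= e; have ez : z = x by apply: val_inj.
    by rewrite ez hx in hz.
  case: eqP => //= e; have ez : N0 z = x by apply: val_inj.
  have [e'|/eqP ne] := eqVneq (N0 z) z; first by rewrite e' if_same.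
  by move: (St_side mT sE s0 ne); rewrite ez hx hz.
pose s2 := run (search 2 1 3 (at2 8 (Reg 1) (Reg 3))) s'.
have e2 : reg s2 2 = N0 x.
  rewrite top_sel //; apply: (@search_spec _ _ X) => //.
    by move=> u /sE.
  move=> s'' u gr ga e3; rewrite /= ga (gr 0) // (gr 1) // e1 e3 (base_n hb') -[k]/(val x) hE'.
  by rewrite eqb0 negbK.
have e1' : reg s2 1 = x by rewrite /s2 run_reg.
have a2 : arr s2 9 = arr s' 9 by rewrite /s2 run_arr.
have -> : run q s' = set_arr (set_arr s2 9 (reg s2 1) (reg s2 2)) 9 (reg s2 2) (reg s2 1) by [].
move=> z; rewrite /= /update /= e1' e2 a2 IH.
have hN : (z == N0 x :> nat) = (N0 z == x).
  by rewrite -[_ == _ :> nat]/(z == N0 x) -(inj_eq (can_inj i0)) i0.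
rewrite hN -[z == x :> nat]/(z == x) /key ltS_or.
have [ez|nz] := eqVneq (N0 z) x.
  have hzz : z = N0 x by rewrite -ez i0.
  suff -> : (if z \in S then z else N0 z) = x by rewrite eqxx ez.
  have [e|/eqP ne] := eqVneq (N0 x) x; first by rewrite ez hzz e if_same.
  by rewrite {1}hzz (St_side mT sE s0 ne) hx.
have [ez|nz'] := eqVneq z x; first by rewrite ez hx eqxx.
case hz : (z \in S).
  by have -> : (z == k :> nat) = false by apply/negP => /eqP h; case/eqP: nz'; apply: val_inj.
by have -> : (N0 z == k :> nat) = false by apply/negP => /eqP h; case/eqP: nz; apply: val_inj.
Qed.

Let L0 := [set x in S | N0 x != x].

Lemma matched_test s x : base s -> vec s 9 (fun z => N0 z) -> reg s 1 = x ->
  ev s (matched_side b) = (x \in L0).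
Proof.
move=> hb h9 e1; have := side_test hb e1; rewrite /= => ->.
rewrite e1 h9 inE -[_ == _ :> nat]/(N0 x == x).
by case: (x \in S); case: (N0 x == x).
Qed.

Lemma ttc_aliveP s : base s -> vec s 9 (fun z => N0 z) ->
  vec (run (ttc_alive b) s) 10 (fun z => z \in L0).
Proof.
move=> hb h9.
pose I (k : nat) s' := forall z, z < k -> arr s' 10 z = (z \in L0).
suff : I n (run (ttc_alive b) s).
  by move=> h z; apply: h.
apply: run_for => // k s' hk e1 fr fa IH z.
have hb' : base s' by apply: (base_frame hb); rewrite ?fr ?fa.
have h9' : vec s' 9 (fun z => N0 z) by rewrite /vec fa.
have em := matched_test hb' h9' (x := Ordinal hk) e1.
rewrite -[run _ s']/(set_arr s' 10 (reg s' 1) (ev s' (matched_side b))) em e1 /= /update /= ltS_or.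
case: eqP => /= [e _|_]; last exact: IH.
by have -> : z = Ordinal hk by apply: val_inj.
Qed.

Variable L : {set 'I_n}.
Hypothesis hL : forall x, x \in L -> x \in S /\ N0 x <> x.

Lemma ttc_favP s : base s -> vec s 9 (fun z => N0 z) -> vec s 10 (fun z => z \in L) ->
  forall x, arr (run ttc_fav s) 11 x = if x \in L then val (fav T N0 L x) else arr s 11 x.
Proof.
move=> hb h9 h10.
pose I (k : nat) s' := forall x, arr s' 11 x =
   if (x \in L) && (x < k) then val (fav T N0 L x) else arr s 11 x.
suff : I n (run ttc_fav s).
  by move=> h x; rewrite h ltn_ord andbT.
apply: run_for => //.
  by move=> x; rewrite ltn0 andbF.
move=> k s' hk e1 fr fa IH; pose x := Ordinal hk.
have hb' : base s' by apply: (base_frame hb); rewrite ?fr ?fa.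
have h9' : vec s' 9 (fun z => N0 z) by rewrite /vec fa.
have h10' : vec s' 10 (fun z => z \in L) by rewrite /vec fa.
rewrite [run _ s'](_ : _ = if x \in L then
  run (search 2 1 3 candx ;; PPut 11 (Reg 1) (Reg 2)) s' else s'); last first.
  by have e1x : reg s' 1 = x := e1; rewrite -(lt0b (x \in L)) -h10' -e1x lt0n.
case: ifP => hx; last first.
  move=> z; rewrite IH ltS_or; case: eqP => //= e.
  by have -> : z = x; [apply: val_inj|rewrite hx].
pose s2 := run (search 2 1 3 candx) s'.
have e2 : reg s2 2 = fav T N0 L x.
  apply: (@search_spec _ _ X) => //.
    by move=> u; apply: (cand_pref gE s0); case: (hL hx).
  move=> s'' u gr ga e3; rewrite /candx /at2 /ix /= !ga (gr 0) // (gr 1) // e1 e3.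
  rewrite (base_n hb') -[k]/(val x).
  rewrite !h9' !h10' !(base_rk hb') /cand /up -[nat_of_ord u == N0 x]/(u == N0 x).
  by case: (_ \in L); case: (u == _); case: (rk T x u < _); case: (rk T u _ < _).
have e1' : reg s2 1 = x by rewrite /s2 run_reg.
have a2 : arr s2 11 = arr s' 11 by rewrite /s2 run_arr.
rewrite -[run _ s']/(set_arr s2 11 (reg s2 1) (reg s2 2)).
move=> z; rewrite /= /update /= e1' e2 a2 IH ltS_or.
rewrite -[nat_of_ord z == x]/(z == x).
by have [->|_] := eqVneq z x; rewrite ?hx.
Qed.

Let C := eventual (point T N0 L) L.

Lemma ttc_markP s : base s -> vec s 9 (fun z => N0 z) -> vec s 10 (fun z => z \in L) ->
  (forall x, x \in L -> arr s 11 x = fav T N0 L x) ->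
  vec (run ttc_mark s) 12 (fun z => z \in C).
Proof.
move=> hb h9 h10 h11; rewrite /ttc_mark.
set p1 := PFor 1 (PPut 12 (Reg 1) (Cst 0)).
have h1 : vec (run p1 s) 12 (fun z => 0).
  pose I (k : nat) s' := forall z, z < k -> arr s' 12 z = 0.
  have : I n (run p1 s).
    apply: run_for => //= k s' hk e1 _ _ IH z; rewrite ltS_or /= e1 /update /=.
    by case: eqP => //= _; apply: IH.
  by move=> h z; apply: h.
set s1 := run p1 s in h1.
have hb1 : base s1 by apply: base_run.
have a9 : arr s1 9 = arr s 9 by rewrite /s1 run_arr.
have a10 : arr s1 10 = arr s 10 by rewrite /s1 run_arr.
have a11 : arr s1 11 = arr s 11 by rewrite /s1 run_arr.
set p2 := PFor 1 _; rewrite -[run _ s]/(run p2 s1).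
pose f := point T N0 L.
have fL x : x \in L -> f x \in L by move=> hx; case: (favP gE s0 hL hx) => /andP[].
pose I (k : nat) s' := forall z, arr s' 12 z =
   [exists x, [&& x \in L, x < k & iter n f x == z]].
suff : I n (run p2 s1).
  move=> h z; rewrite h; congr nat_of_bool.
  apply/existsP/imsetP => [[x /and3P[h2 _ /eqP h3]]|[x h2 h3]].
    by exists x => //; rewrite card_ord.
  by exists x; rewrite h2 ltn_ord h3 card_ord eqxx.
apply: run_for => //.
  by move=> z; rewrite h1; case: existsP => // -[x]; rewrite ltn0 andbF.
move=> k s' hk e1 fr fa IH; pose x := Ordinal hk.
have hb' : base s' by apply: (base_frame hb1); rewrite ?fr ?fa.
have h9' : vec s' 9 (fun z => N0 z) by rewrite /vec fa // a9.
have h10' : vec s' 10 (fun z => z \in L) by rewrite /vec fa // a10.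
have h11' z : z \in L -> arr s' 11 z = fav T N0 L z by rewrite fa // a11; apply: h11.
have exS z : [exists x, [&& x \in L, x < k.+1 & iter n f x == z]] =
   [exists x, [&& x \in L, x < k & iter n f x == z]] || ((x \in L) && (iter n f x == z)).
  apply/existsP/orP => [[u /and3P[g1 g2 g3]]|[/existsP[u /and3P[g1 g2 g3]]|/andP[g1 g2]]].
  - move: g2; rewrite ltS_or => /orP[/eqP e|g2]; last first.
      by left; apply/existsP; exists u; rewrite g1 g2 g3.
    by right; have <- : u = x; [apply: val_inj|rewrite g1 g3].
  - by exists u; rewrite g1 g3 ltS_or g2 orbT.
  - by exists x; rewrite g1 g2 /= ltnS leqnn.
set q := (PSet 2 (Reg 1) ;; _).
rewrite [run _ s'](_ : _ = if x \in L then run q s' else s'); last first.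
  by have e1x : reg s' 1 = x := e1; rewrite -(lt0b (x \in L)) -h10' -e1x lt0n.
case: ifP => hx; last by move=> z; rewrite exS hx orbF IH.
set s2 := set_reg s' 2 x.
set s3 := run (PFor 3 (PSet 2 (Get 9 (Get 11 (Reg 2))))) s2.
have e3 : reg s3 2 = iter n f x.
  pose J (j : nat) t := reg t 2 = iter j f x.
  suff : J n s3 by [].
  apply: run_for => // j t hj _ _ ga /= IHt.
  by rewrite IHt !ga //= h11' ?iter_in // h9'.
have a3 : arr s3 12 = arr s' 12 by rewrite /s3 run_arr.
have -> : run q s' = set_arr s3 12 (reg s3 2) 1 by rewrite /q /= e1.
move=> z; rewrite /= /update /= e3 a3 IH exS hx /= -[_ == _ :> nat]/(z == iter n f x) eq_sym.
by case: (_ == z); rewrite ?orbT ?orbF.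
Qed.

Lemma ttc_killP s : vec s 10 (fun z => z \in L) -> vec s 12 (fun z => z \in C) ->
  vec (run ttc_kill s) 10 (fun z => z \in L :\: C).
Proof.
move=> h10 h12.
pose I (k : nat) s' := forall z, arr s' 10 z = (z \in L) && ~~ ((z \in C) && (z < k)).
suff : I n
    (run ttc_kill s).
  by move=> h z; rewrite h ltn_ord andbT inE andbC.
apply: run_for => //.
  by move=> z; rewrite ltn0 andbF andbT.
move=> k s' hk e1 fr fa IH z; rewrite [run _ _]/= !fa // e1.
rewrite -[k in arr s 12 k]/(val (Ordinal hk)) h12 eqb0 negbK ltS_or.
case: ifP => hx /=; rewrite /update /= ?e1 IH.
  case: eqP => //= e; have -> : z = Ordinal hk by apply: val_inj.
  by rewrite hx andbF.
case: eqP => //= e; have -> : z = Ordinal hk by apply: val_inj.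
by rewrite hx.
Qed.

End VerifyTrading.

Section VerifyTtc.
Variables (n : nat) (T : instance 'I_n) (X : {set 'I_n}).
Implicit Types (s : state) (x y z u v : 'I_n).
Local Notation run := (run n).
Local Notation base := (base T X).

Lemma ttc_addP (b : bool) (S : {set 'I_n}) (E : rel 'I_n) (N0 M : {ffun 'I_n -> 'I_n}) s :
  marriage T S -> (forall z, (z \in S) = ((z \in X) == b)) ->
  good T (addM E M) -> St T (addM E M) M -> St T (addM E M) N0 ->
  base s -> vec s 9 (fun z => N0 z) -> mat s 8 (fun x y => E x y) ->
  (forall x, x \in S -> N0 x <> x -> arr s 11 x = M x) ->
  mat (run (ttc_add b) s) 8 (fun x y => addM E M x y).
Proof.
move=> mT hS gM sM sN hb h9 h8 h11.
have iM := St_invol sM.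
(* The program tests who is matched in [N0]. Both matchings are stable in the same good table, so
   they match the same agents. *)
have mM x : M x <> x -> N0 x <> x.
  by move=> /(St_edge sM) h; apply: (edge_matched gM sN h).
have mN x : N0 x <> x -> M x <> x.
  by move=> /(St_edge sN) h; apply: (edge_matched gM sM h).
pose key u v := if u \in S then u else v.
pose I (k : nat) s' := forall u v, arr s' 8 (u * n + v) =
  (E u v || [&& M u == v, M u != u & key u v < k]).
suff : I n (run (ttc_add b) s).
  by move=> h u v; rewrite h ltn_ord andbT.
apply: run_for => //.
  by move=> u v; rewrite ltn0 !andbF orbF h8.
move=> k s' hk e1 fr fa IH.
have [x ex] : exists x : 'I_n, k = x by exists (Ordinal hk).
move: hk e1 IH; rewrite {k}ex => hk e1 IH.
have e1x : reg s' 1 = x := e1.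
have hb' : base s' by apply: (base_frame hb); rewrite ?fr ?fa.
have h9' : vec s' 9 (fun z => N0 z) by rewrite /vec fa.
have em := matched_test hS hb' h9' e1x.
set q := (PSet 2 _ ;; _).
rewrite [run _ s'](_ : _ = if x \in [set x in S | N0 x != x] then run q s' else s'); last first.
  by rewrite -(lt0b (x \in _)) -em lt0n.
have kx u v : (key u v < x.+1) = (key u v == x) || (key u v < x) by rewrite ltS_or.
have inv u v : (M u == v) = (M v == u).
  by rewrite -(inj_eq (can_inj iM)) iM eq_sym.
case: ifP => hx; last first.
  move=> u v; rewrite IH kx.
  have [ek|] := eqVneq (key u v) x; rewrite //=.
  suff : ~ (M u = v /\ M u <> u).
    by case: eqP => //= h1; case: eqP => //= h2 []; split.
  case=> h1 h2; move: hx; rewrite inE -ek /key.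
  case hu : (u \in S) => /=; first by rewrite hu /=; move/eqP: (mM _ h2) => ->.
  have hv : v \in S by rewrite -h1 (St_side mT (good_sub gM) sM h2) hu.
  rewrite hv /=; suff : N0 v <> v by move/eqP => ->.
  by apply: mM; rewrite -h1 iM => /esym.
case/setIdP: hx => xS /eqP xN.
have aM : arr s' 11 x = M x by rewrite fa // h11.
have -> : run q s' = set_arr (set_arr (set_reg s' 2 (arr s' 11 x)) 8 (x * n + arr s' 11 x) 1)
    8 (arr s' 11 x * n + x) 1.
  by rewrite /q /= /update /= e1 (base_n hb').
rewrite aM => u v; rewrite /= /update /= !cell_eq IH kx /key.
have yS : M x \notin S by rewrite (St_side mT (good_sub gM) sM (mN _ xN)) xS.
have nyx : M x != x by apply/eqP/mN.
have [eu|nu] := eqVneq u x.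
  rewrite eu xS eqxx /= [x == M x]eq_sym (negbTE nyx) /= ltnn andbF orbF andbT [v == _]eq_sym.
  by case: (M x == v); rewrite ?orbT ?orbF.
have [ev|nv] := eqVneq v x; rewrite ?andbF ?andbT /=.
  rewrite ev; have [eu|nu'] := eqVneq u (M x).
    by rewrite eu (negbTE yS) iM !eqxx eq_sym nyx orbT.
  have -> : (M u == x) = false by rewrite inv eq_sym (negbTE nu').
  by [].
case hu : (u \in S); first by rewrite (negbTE nu).
by rewrite (negbTE nv).
Qed.

Lemma ttcP (b : bool) (S : {set 'I_n}) (E : rel 'I_n) s :
  marriage T S -> (forall z, (z \in S) = ((z \in X) == b)) ->
  good T E -> base s -> mat s 8 (fun x y => E x y) ->
  base (run (ttc b) s) /\ exists (E' : rel 'I_n) M tm,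
    [/\ mat (run (ttc b) s) 8 (fun x y => E' x y), good T E',
        forall m, St T E m -> St T E' m, St T E' M & acyclic_over T S M tm].
Proof.
move=> mT hS gE hb h8.
have [N0 s0 top0] := top_exists mT gE.
split; first exact: base_run.
rewrite /ttc; set s1 := run (ttc_top b) s.
have hb1 : base s1 by apply: base_run.
have v1 : vec s1 9 (fun z => N0 z) by apply: (ttc_topP mT hS gE s0 top0 hb h8).
have m1 : mat s1 8 (fun x y => E x y) by rewrite /mat /s1 run_arr.
set s2 := run (ttc_alive b) s1.
have hb2 : base s2 by apply: base_run.
have v2 : vec s2 9 (fun z => N0 z) by rewrite /vec /s2 run_arr.
have m2 : mat s2 8 (fun x y => E x y) by rewrite /mat /s2 run_arr.
have l2 : vec s2 10 (fun z => z \in [set x in S | N0 x != x]).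
  exact: (ttc_aliveP hS hb1 v1).
pose body := (ttc_fav ;; ttc_mark ;; ttc_kill).
set s3 := run (PFor 4 body) s2.
have hb3 : base s3 by apply: base_run.
have v3 : vec s3 9 (fun z => N0 z) by rewrite /vec /s3 run_arr.
have m3 : mat s3 8 (fun x y => E x y) by rewrite /mat /s3 run_arr.
(* Array 11 is not written for agents that have left, so it keeps the favourite of their last round,
   which is their partner in the final matching. *)
pose I (k : nat) s' := exists L h tm, [/\ trading T S N0 L h tm k,
  vec s' 10 (fun z => z \in L) &
  forall x, x \in S -> N0 x <> x -> x \notin L -> arr s' 11 x = N0 ((h : {perm 'I_n}) x)].
have [L [h [tm [htr _ h11]]]] : I n s3.
  apply: run_for => //.
    exists [set x in S | N0 x != x], 1%g, (fun _ => 0); split=> //.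
      exact: trading_init.
    by move=> x h1 /eqP h2; rewrite inE h1 h2.
  move=> k s' hk _ fr fa [L [h [tm [htr hl h11]]]].
  have hb' : base s' by apply: (base_frame hb2); rewrite ?fr ?fa.
  have v' : vec s' 9 (fun z => N0 z) by rewrite /vec fa.
  have [h' [tm' [htr' hC hnC]]] := trading_round mT gE s0 htr.
  have hL := tr_L htr.
  set C := eventual _ _ in htr' hC hnC.
  exists (L :\: C), h', tm'; rewrite -[run body s']/(run ttc_kill (run ttc_mark (run ttc_fav s'))).
  set t1 := run ttc_fav s'; set t2 := run ttc_mark t1; set t3 := run ttc_kill t2.
  have f1 := ttc_favP gE s0 hL hb' v' hl.
  have b1 : base t1 by apply: base_run.
  have w1 : vec t1 9 (fun z => N0 z) by rewrite /vec /t1 run_arr.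
  have k1 : vec t1 10 (fun z => z \in L) by rewrite /vec /t1 run_arr.
  have g1 : forall x, x \in L -> arr t1 11 x = fav T N0 L x.
    by move=> x hx; rewrite f1 hx.
  have c2 : vec t2 12 (fun z => z \in C) := ttc_markP gE s0 hL b1 w1 k1 g1.
  have k2 : vec t2 10 (fun z => z \in L) by rewrite /vec /t2 run_arr.
  have a3 : arr t3 11 = arr t1 11 by rewrite /t3 run_arr // /t2 run_arr.
  split=> //; first exact: (ttc_killP k2 c2).
  move=> x hx nx; rewrite a3 inE negb_and negbK; case hxC : (x \in C) => /=.
    move=> _; rewrite hC //; apply: g1.
    have fL : forall x, x \in L -> point T N0 L x \in L.
      by move=> z hz; case: (favP gE s0 hL hz) => /andP[].
    exact: (eventual_sub fL hxC).
  move=> xL; rewrite f1 (negbTE xL) hnC ?hxC //; exact: h11.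
have eL : L = set0.
  (* Every round with agents left removes at least one, so [n] rounds empty [L]. *)
  case: (tr_card htr) => //; rewrite card_ord -[X in _ <= X]add0n leq_add2r leqn0 cards_eq0.
  by move/eqP.
rewrite {L}eL in htr h11.
have htr' : trading T S N0 set0 h tm #|'I_n| by rewrite card_ord.
have [gM mono sM aM] := trading_end mT gE s0 top0 htr'.
set M := swap S N0 h in gM mono sM aM.
exists (addM E M), M, tm; split=> //.
rewrite -[run _ s]/(run (ttc_add b) s3).
apply: (ttc_addP mT hS gM sM (mono _ s0) hb3 v3 m3).
by move=> x xS xN; rewrite h11 ?inE // /M ffunE xS.
Qed.

End VerifyTtc.

(** * Correctness of the rotation phase *)

Definition nextx (a c : nat) : expr :=
  andx (at2 8 (Reg a) (Reg 4)) (ltx (at2 7 (Reg a) (Reg c)) (at2 7 (Reg a) (Reg 4))).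

Definition hitx : expr :=
  andx (eqx (Reg 3) (Reg 1))
    (andx (ltx (at2 7 (Reg 1) (Reg 5)) (at2 7 (Reg 1) (Reg 2)))
          (ltx (at2 7 (Reg 1) (Reg 2)) (at2 7 (Reg 1) (Reg 8)))).

(* Registers 3 and 5 hold the current edge of the walk, register 6 the answer. *)
Definition mid_step : prog :=
  search 8 3 4 (nextx 3 5) ;;
  PIf (eqx (eqx (Reg 8) (Reg 3)) (Cst 0))
    (PIf hitx (PSet 6 (Cst 1)) ;;
     search 9 8 4 (nextx 8 3) ;; PSet 3 (Reg 9) ;; PSet 5 (Reg 8)).

Definition mid_test : prog :=
  search 3 2 4 (nextx 2 1) ;; PSet 5 (Reg 2) ;; PSet 6 (Cst 0) ;; PFor 7 mid_step.

Definition midx : expr :=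
  andx (Get 0 (Reg 1))
    (andx (ltx (at2 7 (Reg 1) (Reg 2)) (at2 7 (Reg 1) (Reg 1)))
          (eqx (at2 8 (Reg 1) (Reg 2)) (Cst 0))).

Definition link : prog :=
  PPut 8 (ix (Reg 1) (Reg 2)) (Cst 1) ;; PPut 8 (ix (Reg 2) (Reg 1)) (Cst 1).

Definition mid_body : prog := PIf midx (mid_test ;; PIf (Reg 6) link).

Definition mid : prog := PFor 1 (PFor 2 mid_body).

Section VerifyMid.
Variables (n : nat) (T : instance 'I_n) (X : {set 'I_n}).
Implicit Types (s : state) (x y z u v : 'I_n).
Local Notation run := (run n).
Local Notation base := (base T X).
Hypothesis mT : marriage T X.

Section Fixed.
Variable E : rel 'I_n.
Hypothesis gE : good T E.
Let sE := good_sub gE.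

Lemma next_spec dst a c s z y : uniq [:: 0; a; dst; 4] -> c != dst -> c != 4 ->
  base s -> mat s 8 (fun x y => E x y) -> reg s a = z -> reg s c = y ->
  reg (run (search dst a 4 (nextx a c)) s) dst = nx T E z y.
Proof.
move=> hu c1 c2 hb h8 ea ec; apply: (@search_spec _ _ X) => //.
  by move=> u /andP[/sE].
move=> s' u gr ga e4.
rewrite /= !inE !negb_or in hu; case/and4P: hu => /and3P[a0 d0 w0] /andP[da aw] dw _.
rewrite /nextx /at2 /ix /= !ga e4 (gr 0) // (gr a) // (gr c) // ea ec (base_n hb) h8 !(base_rk hb).
by case: (E z u); case: (_ < _).
Qed.

Variables x y : 'I_n.

(** The loop always runs [n] times, so a walk that cannot continue stays where it is, and [found]
    ignores it. *)
Definition walk_next (e : 'I_n * 'I_n) := if nx T E e.1 e.2 == e.1 then e else sig T E e.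

Definition found (e : 'I_n * 'I_n) := (nx T E e.1 e.2 != e.1) && hit T E x y e.

Lemma mid_stepP s (e : 'I_n * 'I_n) (f : bool) : base s -> mat s 8 (fun x y => E x y) ->
  reg s 1 = x -> reg s 2 = y -> reg s 3 = e.1 -> reg s 5 = e.2 -> reg s 6 = f ->
  let s' := run mid_step s in
  [/\ reg s' 3 = (walk_next e).1, reg s' 5 = (walk_next e).2 & reg s' 6 = f || found e].
Proof.
move=> hb h8 r1 r2 r3 r5 r6.
pose s1 := run (search 8 3 4 (nextx 3 5)) s.
have e8 : reg s1 8 = nx T E e.1 e.2 by apply: next_spec.
have q0 : reg s1 0 = n by rewrite /s1 run_reg // (base_n hb).
have [q1 q2 q3 q5 q6] : [/\ reg s1 1 = x, reg s1 2 = y, reg s1 3 = e.1,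
    reg s1 5 = e.2 & reg s1 6 = f] by rewrite /s1 !run_reg.
have hb1 : base s1 by apply: base_run.
have h81 : mat s1 8 (fun x y => E x y) by rewrite /mat /s1 run_arr.
pose p2 := (PIf hitx (PSet 6 (Cst 1)) ;;
     search 9 8 4 (nextx 8 3) ;; PSet 3 (Reg 9) ;; PSet 5 (Reg 8)).
have es : run mid_step s = if nx T E e.1 e.2 == e.1 then s1 else run p2 s1.
  rewrite -[run _ s]/(if ev s1 (eqx (eqx (Reg 8) (Reg 3)) (Cst 0)) != 0 then run p2 s1 else s1).
  by rewrite /= e8 q3 -[nat_of_ord _ == e.1]/(nx T E e.1 e.2 == e.1); case: (nx T E e.1 e.2 == e.1).
rewrite es /walk_next /found; case: eqP => hn; first by rewrite /= orbF.
pose s2 := run (PIf hitx (PSet 6 (Cst 1))) s1.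
have e6 : reg s2 6 = f || hit T E x y e.
  have -> : s2 = if hit T E x y e then set_reg s1 6 1 else s1.
    rewrite /s2 -[run _ s1]/(if ev s1 hitx != 0 then set_reg s1 6 1 else s1).
    rewrite /hitx /at2 /ix /= q0 q1 q2 q3 q5 e8 !(base_rk hb1) /hit.
    rewrite -[nat_of_ord e.1 == x]/(e.1 == x); have [->|ne] := eqVneq e.1 x => //=.
    by case: (rk T x e.2 < _); case: (rk T x y < _).
  by case: (hit T E x y e); rewrite ?orbT ?orbF.
have hb2 : base s2 by apply: base_run.
have h82 : mat s2 8 (fun x y => E x y) by rewrite /mat /s2 run_arr.
have [q32 q82] : reg s2 3 = e.1 /\ reg s2 8 = nx T E e.1 e.2.
  by split; rewrite /s2 run_reg.
pose s3 := run (search 9 8 4 (nextx 8 3)) s2.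
have e9 : reg s3 9 = nx T E (nx T E e.1 e.2) e.1 by apply: next_spec.
have q83 : reg s3 8 = nx T E e.1 e.2 by rewrite /s3 run_reg.
have q63 : reg s3 6 = f || hit T E x y e by rewrite /s3 run_reg.
rewrite -[run p2 s1]/(set_reg (set_reg s3 3 (reg s3 9)) 5 (reg s3 8)) /= /update /=.
by rewrite e9 q83 q63.
Qed.

Lemma mid_testP s : base s -> mat s 8 (fun x y => E x y) -> reg s 1 = x -> reg s 2 = y ->
  reg (run mid_test s) 6 = has (fun i => found (iter i walk_next (start T E x y))) (iota 0 n).
Proof.
move=> hb h8 r1 r2.
pose s1 := run (search 3 2 4 (nextx 2 1)) s.
have e3 : reg s1 3 = nx T E y x by apply: next_spec.
have [q1 q2] : reg s1 1 = x /\ reg s1 2 = y by rewrite /s1 !run_reg.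
have hb1 : base s1 by apply: base_run.
have h81 : mat s1 8 (fun x y => E x y) by rewrite /mat /s1 run_arr.
pose s2 := set_reg (set_reg s1 5 (reg s1 2)) 6 0.
have hb2 : base s2 by apply: (base_frame hb1).
rewrite -[run mid_test s]/(run (PFor 7 mid_step) s2).
pose I (k : nat) s' := [/\ reg s' 3 = (iter k walk_next (start T E x y)).1,
  reg s' 5 = (iter k walk_next (start T E x y)).2 &
  reg s' 6 = has (fun i => found (iter i walk_next (start T E x y))) (iota 0 k)].
suff : I n (run (PFor 7 mid_step) s2) by case.
apply: run_for => //.
move=> k s' hk _ fr fa [i1 i2 i3].
have hb' : base s' by apply: (base_frame hb2); rewrite ?fr ?fa.
have h8' : mat s' 8 (fun x y => E x y) by rewrite /mat fa.
have [||j1 j2 j3] := @mid_stepP s' (iter k walk_next (start T E x y)) _ hb' h8' _ _ i1 i2 i3.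
- by rewrite fr.
- by rewrite fr.
by split=> //; rewrite j3 -[k.+1]addn1 iotaD has_cat /= orbF.
Qed.

Hypotheses (xX : x \in X) (xy : y \in pref T x) (nE : ~~ E x y).

Lemma walk_next_live i : live T X E (start T E x y) ->
  iter i walk_next (start T E x y) = iter i (sig T E) (start T E x y).
Proof.
move=> lv; elim: i => //= i ->; rewrite /walk_next.
by have [_ _ /eqP/negbTE ->] := walk_live mT gE lv i.
Qed.

Lemma found_good : has (fun i => found (iter i walk_next (start T E x y))) (iota 0 n) ->
  good T (addE E x y) /\ forall m, St T E m -> St T (addE E x y) m.
Proof.
case/hasP => i _ /andP[/eqP h1 h2].
have stuck e j : nx T E e.1 e.2 = e.1 -> iter j walk_next e = e.
  by move=> h; elim: j => //= j ->; rewrite /walk_next h eqxx.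
have n2 : nx T E (nx T E y x) y <> nx T E y x.
  by move=> e; move: h1; rewrite (stuck (start T E x y)).
(* If [y] has no worse neighbour, the search returns [y] and the walk starts at [(y, y)]; nothing
   ranks below [y] on its own list, so the walk is stuck at once. *)
have n1 : nx T E y x <> y.
  move=> e; apply: n2; rewrite e; apply: sel_default => w.
  by rewrite negb_and -leqNgt rk_max orbT.
have lv := start_live mT gE xX xy n1 n2.
by rewrite walk_next_live // in h2; apply: (hit_good mT gE xX xy nE n1 n2 h2).
Qed.

Lemma found_of_consistent : consistent T x y E ->
  (exists2 m, St T E m & rk T y x < rk T y (m y)) ->
  (exists2 m, St T E m & rk T y (m y) < rk T y x) ->
  has (fun i => found (iter i walk_next (start T E x y))) (iota 0 n).
Proof.
move=> hc [m0 sm0 h0] h1.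
have hu : exists2 u, E y u & rk T y x < rk T y u.
  case: h1 => m1 sm1 l1; exists (m0 y) => //.
  exact: (edge_partner gE sm0 (St_edge sm1 (lt_matched l1))).
have [n1 n2 [i hi hit_i]] := hit_of_consistent mT gE xX xy nE hc hu h1.
rewrite card_ord in hi.
have lv := start_live mT gE xX xy n1 n2.
apply/hasP; exists i; first by rewrite mem_iota.
rewrite /found walk_next_live // hit_i andbT; apply/eqP.
by have [] := walk_live mT gE lv i.
Qed.

End Fixed.

(** The rank conditions let [N0] and [N1] act as the two stable matchings that [found_of_consistent]
    asks for, at whatever stage the edge is examined. *)
Definition settled (N0 N1 : {ffun 'I_n -> 'I_n}) (E : rel 'I_n) x y :=
  x \in X -> y \in pref T x -> ~~ E x y ->
  rk T y (N1 y) < rk T y x -> rk T y x < rk T y (N0 y) -> ~ consistent T x y E.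

Lemma midxP s (E : rel 'I_n) x y : base s -> mat s 8 (fun x y => E x y) ->
  reg s 1 = x -> reg s 2 = y ->
  (ev s midx != 0) = [&& x \in X, y \in pref T x & ~~ E x y].
Proof.
move=> hb h8 r1 r2; rewrite /midx /at2 /ix /= r1 r2 (base_n hb) h8.
rewrite (base_side hb) !(base_rk hb) rk_self.
by case: (x \in X); case: (y \in pref T x); case: (E x y).
Qed.

Lemma mid_bodyP s (E : rel 'I_n) x y N0 N1 : good T E -> base s ->
  mat s 8 (fun x y => E x y) -> reg s 1 = x -> reg s 2 = y -> St T E N0 -> St T E N1 ->
  exists E' : rel 'I_n,
    [/\ mat (run mid_body s) 8 (fun x y => E' x y), good T E',
        forall m, St T E m -> St T E' m, subrel E E' & settled N0 N1 E' x y].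
Proof.
move=> gE hb h8 r1 r2 s0 s1.
set p := (mid_test ;; PIf (Reg 6) link).
have -> : run mid_body s = if [&& x \in X, y \in pref T x & ~~ E x y] then run p s else s.
  by rewrite -[run _ s]/(if ev s midx != 0 then run p s else s) (midxP hb h8 r1 r2).
case: and3P => [[xX xy nE]|hn]; last first.
  by exists E; split=> // xX xy nE; case: hn.
set t := run mid_test s.
have e6 := mid_testP gE hb h8 r1 r2; rewrite -/t in e6.
have [q0 q1 q2] : [/\ reg t 0 = n, reg t 1 = x & reg t 2 = y].
  by rewrite /t !run_reg // (base_n hb).
have h8t : mat t 8 (fun x y => E x y) by rewrite /mat /t run_arr.
rewrite -[run p s]/(if reg t 6 != 0 then run link t else t) e6 eqb0 negbK.
case: ifP => hf.
  have [gA mono] := found_good gE xX xy nE hf.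
  exists (addE E x y); split=> //.
  - move=> u v; rewrite /= /update /= q0 q1 q2 !cell_eq h8t /addE.
    by case: (u == x); case: (u == y); case: (v == x); case: (v == y); case: (E u v).
  - by move=> u v h; rewrite /addE h.
  - by rewrite /settled /addE !eqxx orbT.
exists E; split=> // _ _ _ l1 l0 hc.
by move: hf; rewrite (found_of_consistent gE xX xy nE hc) //; [exists N0|exists N1].
Qed.

Lemma settled_mono N0 N1 (E E' : rel 'I_n) x y : subrel E E' ->
  (forall m, St T E m -> St T E' m) -> settled N0 N1 E x y -> settled N0 N1 E' x y.
Proof.
move=> sub mono h xX xy nE l1 l0 hc; apply: (h xX xy _ l1 l0).
  by apply: contra nE; apply: sub.
by move=> m /mono; apply: hc.
Qed.

Lemma midP s (E : rel 'I_n) N0 N1 : good T E -> base s ->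
  mat s 8 (fun x y => E x y) -> St T E N0 -> St T E N1 ->
  exists E' : rel 'I_n,
    [/\ mat (run mid s) 8 (fun x y => E' x y), good T E',
        forall m, St T E m -> St T E' m & forall x y, settled N0 N1 E' x y].
Proof.
move=> gE hb h8 s0 s1.
pose I (j k : nat) s' := exists E' : rel 'I_n,
    [/\ mat s' 8 (fun x y => E' x y), good T E', forall m, St T E m -> St T E' m &
      forall x y, (x < j) || ((x == j :> nat) && (y < k)) -> settled N0 N1 E' x y].
suff [E' [h1 h2 h3 h4]] : I n 0 (run mid s).
  by exists E'; split=> // x y; apply: h4; rewrite ltn_ord.
apply: run_for2 => //.
- by exists E; split=> // x y; rewrite !ltn0 andbF.
- move=> j k s' hj hk e1 e2 fr fa [E' [h1 h2 h3 h4]].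
  have hb' : base s' by apply: (base_frame hb); rewrite ?fr ?fa.
  have [E2 [i1 i2 i3 i4 i5]] := @mid_bodyP s' E' (Ordinal hj) (Ordinal hk) N0 N1 h2 hb' h1 e1 e2
    (h3 _ s0) (h3 _ s1).
  exists E2; split; [exact: i1|exact: i2|by move=> m /h3 /i3|].
  move=> x y; rewrite ltS_or.
  have [ex|_] := eqVneq (x : nat) j; have [ey|_] := eqVneq (y : nat) k => //=.
  + move=> _; have -> : x = Ordinal hj by apply: val_inj.
    by have -> : y = Ordinal hk by apply: val_inj.
  + by move=> h; apply: (settled_mono i4 i3); apply: h4; rewrite ex eqxx; rewrite ex in h.
  + by rewrite orbF => h; apply: (settled_mono i4 i3); apply: h4; rewrite h.
  + by rewrite orbF => h; apply: (settled_mono i4 i3); apply: h4; rewrite h.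
- move=> j s' hj [E' [h1 h2 h3 h4]]; exists E'; split=> // x y.
  by rewrite ltn0 andbF orbF ltS_or orbC => h; apply: h4; rewrite ltn_ord andbT.
Qed.

End VerifyMid.

(** * Input, output and the main theorem *)

(** [index] returns the length of the list for an absent agent, so rows start with that value before
    the ranks of acceptable agents are written. *)
Definition init_len : prog := PFor 1 (PFor 2 (PPut 7 (ix (Reg 1) (Reg 2)) (Get 1 (Reg 1)))).

Definition init_rk : prog :=
  PFor 1 (PFor 2 (PIf (ltx (Reg 2) (Get 1 (Reg 1)))
    (PPut 7 (ix (Reg 1) (at2 2 (Reg 1) (Reg 2))) (Reg 2)))).

Definition init_adj : prog :=
  PFor 1 (PFor 2 (PIf (ltx (Reg 2) (Get 3 (Reg 1)))
    (PPut 8 (ix (Reg 1) (at2 4 (Reg 1) (Reg 2))) (Cst 1)))).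

Definition init : prog := init_len ;; init_rk ;; init_adj.

Definition out_step : prog :=
  PIf (ltx (Reg 2) (Get 1 (Reg 1)))
    (PSet 4 (at2 2 (Reg 1) (Reg 2)) ;;
     PIf (at2 8 (Reg 1) (Reg 4)) (PPut 6 (ix (Reg 1) (Reg 3)) (Reg 4) ;; PInc 3)).

Definition out : prog :=
  PFor 1 (PSet 3 (Cst 0) ;; PFor 2 out_step ;; PPut 5 (Reg 1) (Reg 3)).

Definition closure_prog : prog := init ;; ttc true ;; ttc false ;; mid ;; out.

Section VerifyMain.
Variables (n : nat) (T : instance 'I_n) (X : {set 'I_n}).
Implicit Types (s : state) (x y z u v : 'I_n).
Local Notation run := (run n).
Local Notation base := (base T X).

Lemma size_pref (T1 : instance 'I_n) z : size (pref T1 z) <= n.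
Proof. by rewrite -(card_uniqP (pref_uniq T1 z)) -[X in _ <= X]card_ord max_card. Qed.

Lemma length_arrayE (T1 : instance 'I_n) z : length_array T1 z = size (pref T1 z).
Proof. by rewrite /length_array valK. Qed.

Lemma pref_arrayE (T1 : instance 'I_n) z j : j < n ->
  pref_array T1 (z * n + j) = nth 0 (map val (pref T1 z)) j.
Proof.
move=> hj; have n0 : 0 < n by apply: leq_ltn_trans hj.
by rewrite /pref_array divnMDl // divn_small // addn0 valK modnMDl modn_small.
Qed.

Lemma nth_pref (T1 : instance 'I_n) z j : j < size (pref T1 z) ->
  exists w : 'I_n,
    [/\ nth 0 (map val (pref T1 z)) j = w, index w (pref T1 z) = j & w \in pref T1 z].
Proof.
move=> hj; exists (nth z (pref T1 z) j); rewrite (nth_map z) //; split=> //.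
  by rewrite index_uniq // pref_uniq.
exact: mem_nth.
Qed.

Lemma index_eq_pref (T1 : instance 'I_n) z j w y : index w (pref T1 z) = j ->
  w \in pref T1 z -> (index y (pref T1 z) == j) = (y == w).
Proof.
move=> e hw; apply/eqP/eqP => [e'|->//]; apply/esym.
by apply: (@rk_inj _ T1 z) => //; rewrite /rk e e'.
Qed.

Lemma init_adjP (T0 : instance 'I_n) s : reg s 0 = n ->
  vec s 3 (fun z => size (pref T0 z)) ->
  (forall z j, j < size (pref T0 z) -> arr s 4 (z * n + j) = nth 0 (map val (pref T0 z)) j) ->
  mat s 8 (fun _ _ : 'I_n => 0) ->
  mat (run init_adj s) 8 (fun x y => adj T0 x y).
Proof.
move=> r0 h3 h4 h8.
pose I (j k : nat) s' := forall x y, arr s' 8 (x * n + y) =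
  adj T0 x y && ((x < j) || ((x == j :> nat) && (index y (pref T0 x) < k))).
suff h : I n 0 (run init_adj s) by move=> x y; rewrite h ltn_ord andbT.
apply: run_for2 => //.
- by move=> x y; rewrite h8 !ltn0 andbF andbF.
- move=> j k s' hj hk e1 e2 fr fa IH.
  have [z ez] : exists z : 'I_n, j = z by exists (Ordinal hj).
  move: e1 IH; rewrite {j hj}ez => e1 IH.
  have hl : arr s' 3 z = size (pref T0 z) by rewrite fa // h3.
  rewrite [run _ s'](_ : _ = if k < size (pref T0 z) then
      set_arr s' 8 (z * n + arr s' 4 (z * n + k)) 1 else s'); last first.
    by rewrite /= e1 e2 hl fr // r0; case: (k < _).
  case: ltnP => hks.
    have [w [ew iw mw]] := nth_pref hks.
    rewrite [arr s' 4 _](_ : _ = nat_of_ord w); last by rewrite fa // h4.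
    move=> x y; rewrite /= /update /= cell_eq IH ltS_or.
    rewrite -[nat_of_ord x == z]/(x == z).
    have [->|] := eqVneq x z; rewrite //= (index_eq_pref _ iw mw).
    by have [->|_] := eqVneq y w; rewrite //= /adj mw orbT.
  move=> x y; rewrite IH ltS_or -[nat_of_ord x == z]/(x == z).
  have [->|] := eqVneq x z => //=; rewrite /adj -index_mem.
  by case: eqP => // ->; rewrite ltnNge hks.
- move=> j s' hj IH x y; rewrite IH ltS_or ltn0 andbF orbF /adj -index_mem.
  case: ltnP => //= h; rewrite (leq_trans h (size_pref T0 x)) andbT orbC //.
Qed.

Lemma init_lenP s : reg s 0 = n -> vec s 1 (fun z => size (pref T z)) ->
  mat (run init_len s) 7 (fun x (_ : 'I_n) => size (pref T x)).
Proof.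
move=> r0 h1.
pose I (j k : nat) s' := forall x y, (x < j) || ((x == j :> nat) && (y < k)) ->
  arr s' 7 (x * n + y) = size (pref T x).
suff h : I n 0 (run init_len s) by move=> x y; rewrite h ?ltn_ord.
apply: run_for2 => //.
- by move=> x y; rewrite !ltn0 andbF.
- move=> j k s' hj hk e1 e2 fr fa IH.
  have [z ez] : exists z : 'I_n, j = z by exists (Ordinal hj).
  have [w ew] : exists w : 'I_n, k = w by exists (Ordinal hk).
  move: e1 e2 IH; rewrite {j hj}ez {k hk}ew => e1 e2 IH x y.
  rewrite /= /update /= e1 e2 fr // r0 cell_eq fa // h1 ltS_or.
  rewrite -[nat_of_ord x == z]/(x == z) -[nat_of_ord y == w]/(y == w) => h.
  case: ifP => [/andP[/eqP-> _] //|ne]; apply: IH; move: h ne.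
  rewrite -[nat_of_ord x == z]/(x == z).
  by case: (x == z); case: (y == w).
- move=> j s' hj IH x y; rewrite ltn0 andbF orbF ltS_or => h; apply: IH.
  by rewrite ltn_ord andbT orbC.
Qed.

Lemma init_rkP s : reg s 0 = n -> vec s 1 (fun z => size (pref T z)) ->
  (forall z j, j < size (pref T z) -> arr s 2 (z * n + j) = nth 0 (map val (pref T z)) j) ->
  mat s 7 (fun x (_ : 'I_n) => size (pref T x)) ->
  mat (run init_rk s) 7 (rk T).
Proof.
move=> r0 h3 h4 h8.
pose I (j k : nat) s' := forall x y, arr s' 7 (x * n + y) =
  if (x < j) || ((x == j :> nat) && (rk T x y < k)) then rk T x y else size (pref T x).
suff h : I n 0 (run init_rk s) by move=> x y; rewrite h ltn_ord.
apply: run_for2 => //.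
- by move=> x y; rewrite h8 !ltn0 andbF.
- move=> j k s' hj hk e1 e2 fr fa IH.
  have [z ez] : exists z : 'I_n, j = z by exists (Ordinal hj).
  move: e1 IH; rewrite {j hj}ez => e1 IH.
  have hl : arr s' 1 z = size (pref T z) by rewrite fa // h3.
  rewrite [run _ s'](_ : _ = if k < size (pref T z) then
      set_arr s' 7 (z * n + arr s' 2 (z * n + k)) k else s'); last first.
    by rewrite /= e1 e2 hl fr // r0; case: (k < _).
  case: ltnP => hks.
    have [w [ew iw mw]] := nth_pref hks.
    rewrite [arr s' 2 _](_ : _ = nat_of_ord w); last by rewrite fa // h4.
    move=> x y; rewrite /= /update /= cell_eq IH ltS_or.
    rewrite -[nat_of_ord x == z]/(x == z).
    have [->|] := eqVneq x z; rewrite //= /rk (index_eq_pref _ iw mw).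
    by have [->|_] := eqVneq y w; rewrite //= iw orbT.
  move=> x y; rewrite IH ltS_or -[nat_of_ord x == z]/(x == z).
  have [->|] := eqVneq x z => //=.
  have [e|//] := eqVneq (rk T z y) k; rewrite e !ltnn /=.
  by apply/eqP; rewrite eqn_leq hks -e index_size.
- move=> j s' hj IH x y; rewrite IH ltS_or ltn0 andbF orbF.
  case: ltnP => //= _; rewrite ?orbT ?orbF //; case: eqP => //= _.
  case: ltnP => // h; apply/eqP.
  by rewrite eqn_leq index_size (leq_trans (size_pref T x) h).
Qed.

Lemma initP (T0 : instance 'I_n) (s := input_state T X T0) :
  base (run init s) /\ mat (run init s) 8 (fun x y => adj T0 x y).
Proof.
have side : vec s 0 (fun z => z \in X) by move=> z; rewrite /= /side_array valK.
have len1 : vec s 1 (fun z => size (pref T z)) by move=> z; apply: length_arrayE.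
have len3 : vec s 3 (fun z => size (pref T0 z)) by move=> z; apply: length_arrayE.
have pr2 z j : j < size (pref T z) -> arr s 2 (z * n + j) = nth 0 (map val (pref T z)) j.
  by move=> h; apply: pref_arrayE; apply: leq_trans (size_pref T z).
have pr4 z j : j < size (pref T0 z) -> arr s 4 (z * n + j) = nth 0 (map val (pref T0 z)) j.
  by move=> h; apply: pref_arrayE; apply: leq_trans (size_pref T0 z).
rewrite -[run init s]/(run init_adj (run init_rk (run init_len s))).
set s1 := run init_len s; set s2 := run init_rk s1; set s3 := run init_adj s2.
have m1 : mat s1 7 (fun x (_ : 'I_n) => size (pref T x)) by apply: init_lenP.
have a1 a : a != 7 -> arr s1 a = arr s a by move=> h; rewrite /s1 run_arr // inE.
have a2 a : a != 7 -> arr s2 a = arr s a by move=> h; rewrite /s2 run_arr ?a1 // inE.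
have a3 a : a != 7 -> a != 8 -> arr s3 a = arr s a by move=> h h'; rewrite /s3 run_arr ?a2 // inE.
have r1 : reg s1 0 = n by rewrite /s1 run_reg.
have r2 : reg s2 0 = n by rewrite /s2 run_reg.
have m2 : mat s2 7 (rk T).
  apply: init_rkP => //; first by move=> z; rewrite a1.
  by move=> z j h; rewrite a1 // pr2.
split; last first.
  apply: init_adjP => //.
  - by move=> z; rewrite a2.
  - by move=> z j h; rewrite a2 // pr4.
  - by move=> x y; rewrite a2.
split.
- by rewrite /s3 run_reg.
- by move=> z; rewrite a3.
- by move=> z; rewrite a3.
- by move=> z j h; rewrite a3 // pr2.
- by move=> x y; rewrite /s3 run_arr.
Qed.

Lemma outP s (E : rel 'I_n) : base s -> mat s 8 (fun x y => E x y) ->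
  forall z, map val (table_pref T E z) =
    mkseq (fun j => arr (run out s) 6 (z * n + j)) (arr (run out s) 5 z).
Proof.
move=> hb h8.
pose row s' z (l : seq 'I_n) := forall i, i < size l -> arr s' 6 (z * n + i) = nth 0 (map val l) i.
pose I (k : nat) s' := forall z, z < k ->
  arr s' 5 z = size (table_pref T E z) /\ row s' z (table_pref T E z).
have szt z : size (table_pref T E z) <= n.
  by rewrite size_filter (leq_trans (count_size _ _)) ?size_pref.
suff h : I n (run out s).
  move=> z; have [h1 h2] := h z (ltn_ord z); rewrite h1.
  apply: (@eq_from_nth _ 0); rewrite size_map ?size_mkseq // => i hi.
  by rewrite nth_mkseq // h2.
apply: run_for => //.
move=> k s' hk e1 fr fa IH.
have [z ez] : exists z : 'I_n, k = z by exists (Ordinal hk).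
move: e1 IH; rewrite {k hk}ez => e1 IH.
have hb' : base s' by apply: (base_frame hb); rewrite ?fr ?fa.
have h8' : mat s' 8 (fun x y => E x y) by rewrite /mat fa.
set s1 := set_reg s' 3 0; set s2 := run (PFor 2 out_step) s1.
rewrite [run _ s'](_ : _ = set_arr s2 5 (reg s2 1) (reg s2 3)) //.
pose J (j : nat) t := [/\ reg t 3 = size [seq w <- take j (pref T z) | E z w],
   row t z [seq w <- take j (pref T z) | E z w] &
   forall z', z' < z -> row t z' (table_pref T E z')].
have [j1 j2 j3] : J n s2.
  apply: run_for => //.
    by split; rewrite ?take0 // => z' hz; case: (IH _ hz).
  move=> j t hj f2 gr ga [j1 j2 j3].
  have t1 : reg t 1 = z by rewrite gr.
  have t0 : reg t 0 = n by rewrite gr //; apply: (base_n hb').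
  have hl : arr t 1 z = size (pref T z) by rewrite ga //; apply: (base_len hb').
  pose q := (PSet 4 (at2 2 (Reg 1) (Reg 2)) ;;
    PIf (at2 8 (Reg 1) (Reg 4)) (PPut 6 (ix (Reg 1) (Reg 3)) (Reg 4) ;; PInc 3)).
  rewrite [run _ t](_ : _ = if j < size (pref T z) then run q t else t); last first.
    by rewrite /= t1 f2 hl; case: (j < _).
  case: ltnP => hjs; last first.
    by rewrite /J !take_oversize // ?(leq_trans hjs) // in j1 j2 *.
  have ew : arr t 2 (z * n + j) = nth z (pref T z) j.
    by rewrite ga // (base_pref hb') // (nth_map z).
  set w := nth z (pref T z) j in ew.
  have hE : arr t 8 (z * n + w) = E z w by rewrite ga //; apply: h8'.
  have tk : [seq w <- take j.+1 (pref T z) | E z w] =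
      if E z w then rcons [seq w <- take j (pref T z) | E z w] w
      else [seq w <- take j (pref T z) | E z w].
    by rewrite (take_nth z) // filter_rcons.
  rewrite [run q t](_ : _ = if E z w then
      set_reg (set_arr (set_reg t 4 w) 6 (z * n + reg t 3) w) 3 (reg t 3 + (reg t 3 < n))
    else set_reg t 4 w); last first.
    by rewrite /q /= /update /= t1 t0 f2 ew hE; case: (E z w).
  rewrite /J tk; case: ifP => hzw; last by split.
  set l := [seq w <- _ | _] in j1 j2 *.
  (* The write position is still below [n], so [PInc] does not saturate and the cell stays in row
     [z]. *)
  have hsz : size l < n.
    rewrite size_filter (leq_ltn_trans (count_size _ _)) // size_take.
    by rewrite hjs.
  split.
  - by rewrite /= /update /= j1 hsz size_rcons addn1.
  - move=> i; rewrite size_rcons ltS_or /= /update /= eqn_add2l j1 map_rcons nth_rcons size_map.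
    by case: eqP => [->|_ /= hi]; rewrite ?ltnn //= hi j2.
  - move=> z' hz' i hi; rewrite /= /update /=.
    have hi' : i < n := leq_trans hi (szt z').
    have := cell_eq z' (Ordinal hi') z (Ordinal hsz); rewrite /= j1 => ->.
    have -> : (z' == z) = false by apply/negP => /eqP e; rewrite e ltnn in hz'.
    exact: j3.
have r1 : reg s2 1 = z by rewrite /s2 run_reg.
move=> z'; rewrite ltS_or /= /update /= r1; case: eqP => [e _|_ /= h].
  have -> : z' = z by apply: val_inj.
  have ee : [seq w <- take n (pref T z) | E z w] = table_pref T E z.
    by rewrite take_oversize // size_pref.
  by rewrite j1 ee; split=> //; rewrite -ee.
have [i1 _] := IH _ h; split; last exact: j3.
by rewrite /s2 run_arr.
Qed.

Lemma input_bounded (T0 : instance 'I_n) : bounded n (input_state T X T0).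
Proof.
have hp (T1 : instance 'I_n) i : pref_array T1 i < n.+2.
  rewrite /pref_array; case: insubP => [z _ _|//].
  have [h|h] := ltnP (i %% n) (size (map val (pref T1 z))); last by rewrite nth_default.
  rewrite size_map in h; have [w [-> _ _]] := nth_pref h; have := ltn_ord w; lia.
have hl (T1 : instance 'I_n) i : length_array T1 i < n.+2.
  rewrite /length_array; case: insubP => [z _ _|//].
  have := size_pref T1 z; lia.
split=> [r|a i] /=; first by case: eqP => //; lia.
do 5?[case: a => [|a] //].
by rewrite /side_array; case: insub => // z; case: (z \in X).
Qed.

End VerifyMain.

Theorem theorem1 :
  exists (p : cmd) (k c n0 : nat),
    forall (n : nat) (T : instance 'I_n) (X : {set 'I_n}) (T0 : instance 'I_n),
      marriage T X -> subtable T0 T -> stable_table T0 ->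
      exists (t : nat) (s : state) (T' : instance 'I_n),
        [/\ exec (n.+2 ^ k) p (input_state T X T0) t s,
            n0 <= n -> t <= c * n ^ 4,
            output_is s T',
            subtable T' T &
            internal_closure T (stable_matchings T0) (stable_matchings T')].
Proof.
have [c hc] := cost_bound closure_prog.
(* 9 is the word exponent of [run_exec]. The time bound starts at [n0 = 1], because [n ^ 4] vanishes
   at 0 while the program still takes time. The exponent 4 is the loop depth, attained in [mid]. *)
exists (compile closure_prog), 9, c, 1 => n T X T0 mT hsub hst.
have [|||[t hex ht] _] := @run_exec n closure_prog (input_state T X T0) => //.
  exact: input_bounded.
set s0 := input_state T X T0 in hex *.
have [b1 m1] := initP T X T0; set s1 := run n init _ in b1 m1.
have gE := adj_good hsub hst.
have h2 := @ttcP n T X true X (adj T0) s1 mT (fun z => esym (eqb_id _)) gE b1 m1.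
set s2 := run n (ttc true) s1 in h2.
case: h2 => b2 [E2 [N0 [tm0 [m2 g2 mono2 sN0 a0]]]].
have hC : forall z, (z \in ~: X) = ((z \in X) == false) by move=> z; rewrite inE; case: (z \in X).
have h3 := @ttcP n T X false (~: X) E2 s2 (marriageC mT) hC g2 b2 m2.
set s3 := run n (ttc false) s2 in h3.
case: h3 => b3 [E3 [N1 [tm1 [m3 g3 mono3 sN1 a1]]]].
have [E4 [m4 g4 mono4 hset]] := midP mT g3 b3 m3 (mono3 _ sN0) sN1.
set s4 := run n mid s3 in m4.
have b4 : base T X s4 by apply: base_run.
have sE := good_sub g4; have yE := good_sym g4.
exists t, (run n closure_prog s0), (table sE yE); split=> //.
- move=> n1; exact: leq_trans ht (hc n n1).
- exact: (outP b4 m4).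
- exact: table_subtable.
apply: (table_closure sE yE hsub); first by move=> m /mono2 /mono3 /mono4.
move=> m im pm c1 c2.
have mid_settled x y := hset x y.
(* [a0] and [a1] date from earlier tables and are used unchanged; only the stability of [N0] and
   [N1] had to be carried forward. *)
exact: (compatible_stable mT g4 (mono4 _ (mono3 _ sN0)) (mono4 _ sN1) a0 a1 mid_settled im pm c1 c2).
Qed.
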